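(* Let $\Omega\subset\mathbb{D}$ be an open set, bounded with respect to the hyperbolic metric $d_h$. Then zero is not an eigenvalue of $\mathcal{L}_h:L^2(\Omega)\to L^2(\Omega)$.
   Context: $\mathbb{D}=\{z\in\mathbb{C}:|z|<1\}$ is the Poincaré disk; $[z,w]=\left|\frac{z-w}{1-\overline{z}w}\right|$ is the pseudo-hyperbolic distance; $d_h(z,w)=2\tanh^{-1}[z,w]$ is the hyperbolic distance. Let $d\mu(w)=\frac1\pi\frac{dA(w)}{(1-|w|^2)^2}$ with $dA$ the Lebesgue area measure; $L^2(\Omega)$ is the space of (real-valued) functions square integrable on $\Omega$ with respect to $\mu$. The hyperbolic logarithmic potential operator is $\mathcal{L}_hu(z)=\frac12\int_\Omega\log\frac{1}{[z,w]}\,u(w)\,d\mu(w)$, $z\in\Omega$. A number $\tau$ is an eigenvalue if there is $0\neq u\in L^2(\Omega)$ with $\mathcal{L}_hu=\tau u$ in $L^2(\Omega)$. *)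

(* Defs.v *)
From HB Require Import structures.
From mathcomp Require Import all_boot all_order all_algebra.
From mathcomp Require Import complex.
From mathcomp Require Import all_classical all_reals all_analysis.
From mathcomp Require Import measurable_realfun.

Set Implicit Arguments.
Unset Strict Implicit.
Unset Printing Implicit Defensive.

Import Order.TTheory GRing.Theory Num.Theory.
Import numFieldNormedType.Exports.
Import ComplexField.Normc.

Local Open Scope classical_set_scope.
Local Open Scope ring_scope.

(* Sets of complex numbers are represented as subsets of the real plane, with
   its product topology and product Borel sets; the library's Lebesgue measure
   lives on [measurableTypeR R], the type [R] with its Borel sets. *)
Notation plane R := (measurableTypeR R * measurableTypeR R)%type.

Section hyperbolic_disk.
Context {R : realType}.
Implicit Types (z w : plane R) (Omega : set (plane R)).

Definition cplx z : R[i] := Complex z.1 z.2.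

Definition unit_disk : set (plane R) := [set z | normc (cplx z) < 1].

Definition pseudo_hyp_dist z w : R :=
  normc ((cplx z - cplx w) / (1 - conjc (cplx z) * cplx w)).

Definition artanh (x : R) : R := 2^-1 * ln ((1 + x) / (1 - x)).

Definition hyp_dist z w : R := 2 * artanh (pseudo_hyp_dist z w).

Definition hyp_bounded Omega : Prop :=
  exists M : R, forall z w, Omega z -> Omega w -> hyp_dist z w <= M.

Definition area : {measure set (plane R) -> \bar R} :=
  (@lebesgue_measure R \x @lebesgue_measure R)%E.

Definition hyp_density z : R := pi^-1 * ((1 - normc (cplx z) ^+ 2) ^+ 2)^-1.

(* A measure on the plane that gives measure 0 to the complement of the disk. *)
Definition hyp_measure (A : set (plane R)) : \bar R :=
  (\int[area]_(w in A `&` unit_disk) (hyp_density w)%:E)%E.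

Lemma normc_cplxE z : normc (cplx z) ^+ 2 = (z.1 : R) ^+ 2 + (z.2 : R) ^+ 2.
Proof. by rewrite /normc /cplx sqr_sqrtr// addr_ge0 ?sqr_ge0. Qed.

Lemma unit_diskE z : unit_disk z <-> (z.1 : R) ^+ 2 + (z.2 : R) ^+ 2 < 1.
Proof.
rewrite -normc_cplxE /unit_disk /=.
have n0 : 0 <= normc (cplx z) by exact: sqrtr_ge0.
by rewrite expr_lt1.
Qed.

Lemma measurable_normc2 :
  measurable_fun [set: plane R] (fun z => normc (cplx z) ^+ 2).
Proof.
under eq_fun do rewrite normc_cplxE.
by apply: measurable_funD; apply: measurable_funX;
  [exact: measurable_fst|exact: measurable_snd].
Qed.

Lemma measurable_unit_disk : measurable unit_disk.
Proof.
rewrite (_ : unit_disk = [set: plane R] `&`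
    (fun z => normc (cplx z) ^+ 2) @^-1` `]-oo, 1[%classic).
  exact: measurable_normc2.
apply/seteqP; split=> z; rewrite /= in_itv/= normc_cplxE.
- by move=> /unit_diskE.
- by move=> [_ /unit_diskE].
Qed.

Lemma hyp_density_ge0 z : 0 <= hyp_density z.
Proof. by rewrite /hyp_density mulr_ge0// invr_ge0 ?pi_ge0// sqr_ge0. Qed.

Lemma measurable_hyp_density : measurable_fun [set: plane R] hyp_density.
Proof.
rewrite (_ : hyp_density = fun z =>
    pi^-1 * ((1 - normc (cplx z) ^+ 2) ^+ 2) `^ (-1)); last first.
  by apply/funext => z; rewrite /hyp_density powR_inv1// sqr_ge0.
apply: measurable_funM => //.
apply: (measurableT_comp (measurable_powR _)).
apply: measurable_funX; apply: measurable_funB => //.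
exact: measurable_normc2.
Qed.

Let hyp_measure0 : hyp_measure set0 = 0%E.
Proof. by rewrite /hyp_measure set0I integral_set0. Qed.

Let hyp_measure_ge0 A : (0 <= hyp_measure A)%E.
Proof. by apply: integral_ge0 => z _; rewrite lee_fin hyp_density_ge0. Qed.

Let hyp_measure_sigma_additive : semi_sigma_additive hyp_measure.
Proof.
move=> /= A mA tA mUA.
rewrite /hyp_measure setI_bigcupl ge0_integral_bigcup//=.
- apply: is_cvg_ereal_nneg_natsum_cond => n _ _.
  exact: hyp_measure_ge0.
- by move=> k; apply: measurableI => //; exact: measurable_unit_disk.
- apply: measurable_funTS; apply/measurable_EFinP.
  exact: measurable_hyp_density.
- by move=> z _; rewrite lee_fin hyp_density_ge0.
- exact: trivIset_setIr.
Qed.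

HB.instance Definition _ := isMeasure.Build _ _ _ hyp_measure
  hyp_measure0 hyp_measure_ge0 hyp_measure_sigma_additive.

End hyperbolic_disk.

Section hyperbolic_log_potential.
Context {R : realType}.
Implicit Types (Omega : set (plane R)) (u : plane R -> R).

(* [u] represents an element of L^2(Omega); only its values on [Omega]
   matter. *)
Definition L2_on Omega u : Prop := (u \_ Omega) \in Lfun hyp_measure 2%:E.

(* The value [ln (1 / 0) = 0] of the kernel at [w = z] is irrelevant: points are
   null sets of [hyp_measure]. *)
Definition hyp_log_potential Omega u (z : plane R) : R :=
  2^-1 * (\int[hyp_measure]_(w in Omega)
            (ln (1 / pseudo_hyp_dist z w) * u w))%R.

(* Equality in L^2(Omega) is equality almost everywhere on [Omega]. *)
Definition L2_eigenvalue Omega (T : (plane R -> R) -> (plane R -> R)) (tau : R) :=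
  exists u, [/\ L2_on Omega u,
    ~ ae_eq hyp_measure Omega u (cst 0) &
    ae_eq hyp_measure Omega (T u) (fun z => tau * u z)].

End hyperbolic_log_potential.

(* Main.v *)
(* The kernel is half the Green function G of the disk, and the argument is local.
   For a closed box Q in Omega and polynomials a, b with double zeros at the
   ends of the sides of Q, the test function phi = a(x) b(y) satisfies
     int_Q (Delta phi)(z) G(z, w) dA(z) = - (c / 2) phi(w) 1_Q(w),  c > 0:
   write G(z, w) = (ln |1 - conj z w|^2 - ln |z - w|^2) / 2, integrate by parts
   twice after replacing |z - w|^2 by |z - w|^2 + e, and let e tend to 0, so that
   Delta ln (|z - w|^2 + e) = 4 e / (|z - w|^2 + e)^2 is an approximate identity.
   If the potential of u vanishes, Fubini's theorem makes u orthogonal to all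
   these phi; letting phi increase to the indicator of the open box, u has zero
   integral over every open box, hence u = 0 almost everywhere on Omega.
   Hyperbolic boundedness only serves to make u integrable. *)
From HB Require Import structures.
Require Import Defs.
From mathcomp Require Import all_boot all_order all_algebra.
From mathcomp Require Import complex.
From mathcomp Require Import all_classical all_reals all_analysis.
From mathcomp Require Import measurable_realfun.
From mathcomp Require Import ring lra.

Set Implicit Arguments.
Unset Strict Implicit.
Unset Printing Implicit Defensive.
Import Order.TTheory GRing.Theory Num.Theory.
Import numFieldNormedType.Exports.
Import ComplexField.Normc.

Local Open Scope classical_set_scope.
Local Open Scope ring_scope.

(** * Affine changes of variables *)

(** The point w may lie inside Q, outside it or on its boundary, and one formula has to cover all
    cases. A double zero of a or b kills both boundary terms of a twofold integration by parts along
    a line, so the one-variable fundamental theorem of calculus, applied line by line, takes the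
    place of Stokes' theorem, and polynomials take the place of smooth cutoffs. As functions of z,
    |z - w|^2 + e and |1 - conj z w|^2 both have the form Z = al |z|^2 + be x + ga y + de, for which
    Z Delta Z - |grad Z|^2 is constant: a single identity yields the approximate identity in one
    case and harmonicity in the other. Both the limit in e and Fubini's theorem need an integrable
    majorant of the logarithms. It depends on one coordinate only: |z - w|^2 >= (x - u)^2 for the
    first coordinates x of z and u of w, and ln (x - u)^2 is integrable over a box with a bound
    uniform in w. The variable z is integrated against plain area, where Green's identity lives; the
    hyperbolic weight stays with w. *)

Section affine_change.
Context {R : realType}.
Notation mu := (@lebesgue_measure R).

(** The scaled pushforward [m'] gives every interval []a, b]] its length, and Lebesgue measure is
    the only measure that does. *)
Lemma lebesgue_measure_affine (s u : R) (A : set (measurableTypeR R)) :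
  0 < s -> measurable A ->
  mu A = (s%:E * mu ((fun t => u + s * t)%R @^-1` A))%E.
Proof.
move=> s0 mA.
pose F := fun t : measurableTypeR R => u + s * t : measurableTypeR R.
have mF : measurable_fun setT F.
  by apply: measurable_funD => //; apply: measurable_funM.
pose s' := NngNum (ltW s0).
pose m' := mscale s'
  (measure_function_pushforward__canonical__measure_function_Measure mu mF).
rewrite (lebesgue_measure_unique (mu := m'))// => _ [[a b]/= _ <-].
rewrite /m' /mscale/= /pushforward.
rewrite (_ : F @^-1` _ = `](a - u) / s, (b - u) / s]%classic); last first.
  apply/seteqP; split => t; rewrite /F /= !in_itv/= ltr_pdivrMr// ler_pdivlMr//;
  by rewrite ltrBlDl lerBrDl (mulrC s).
rewrite !lebesgue_measure_itv/= !lte_fin ltr_pM2r ?invr_gt0// ltrD2r.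
case: ifPn => ab; last by rewrite mule0.
rewrite -!EFinB -EFinM; congr EFin; field; exact: lt0r_neq0.
Qed.

Lemma ge0_integral_affine (s u : R) (f : measurableTypeR R -> \bar R) : 0 < s ->
  measurable_fun setT f -> (forall x, 0 <= f x)%E ->
  (\int[mu]_x f x = s%:E * \int[mu]_x f (u + s * x)%R)%E.
Proof.
move=> s0 mf f0.
pose F := fun t : measurableTypeR R => u + s * t : measurableTypeR R.
have mF : measurable_fun setT F.
  by apply: measurable_funD => //; apply: measurable_funM.
pose s' := NngNum (ltW s0).
pose m' := mscale s'
  (measure_function_pushforward__canonical__measure_function_Measure mu mF).
transitivity (\int[m']_x f x)%E.
  apply: eq_measure_integral => A mA _.
  exact: (@lebesgue_measure_affine s u).
rewrite ge0_integral_mscale//=; congr (_ * _)%E.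
by rewrite ge0_integral_pushforward.
Qed.

(** With z = w + s t, the measure 4 s^2 / (|z - w|^2 + s^2)^2 dA(z) becomes [bump t] dA(t), so the
    approximate identities at all scales have the same mass. *)
Lemma ge0_integral_area_affine (s : R) (w : plane R) (f : plane R -> \bar R) :
  0 < s -> measurable_fun setT f -> (forall x, 0 <= f x)%E ->
  (\int[area]_z f z =
   (s ^+ 2)%:E * \int[area]_z f (w.1 + s * z.1, w.2 + s * z.2)%R)%E.
Proof.
move=> s0 mf f0.
have mg : measurable_fun setT (fun z : plane R =>
    f (w.1 + s * z.1, w.2 + s * z.2)%R).
  apply: measurableT_comp => //; apply: measurable_fun_pair => /=.
    by apply: measurable_funD => //; apply: measurable_funM.
  by apply: measurable_funD => //; apply: measurable_funM.
rewrite /area fubini_tonelli1// fubini_tonelli1//=.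
rewrite (@ge0_integral_affine s w.1)//; last 2 first.
  exact: (measurable_fun_fubini_tonelli_F (m2 := mu) f).
  by move=> x; apply: integral_ge0.
rewrite expr2 EFinM -muleA; congr (_ * _)%E.
rewrite -ge0_integralZl//; last 3 first.
- exact: (measurable_fun_fubini_tonelli_F (m2 := mu) _ mg).
- by move=> x _; apply: integral_ge0 => y _.
- by rewrite lee_fin ltW.
apply: eq_integral => x _; rewrite /fubini_F.
rewrite (@ge0_integral_affine s w.2)//.
by apply: measurableT_comp => //; exact: measurable_pair1.
Qed.

End affine_change.

(** * The total mass of the approximate identity *)

Section planar_kernel.
Context {R : realType}.
Notation mu := (@lebesgue_measure R).

Lemma measurable_invr : measurable_fun [set: R] (fun x : R => x^-1).
Proof.
(* This factorization also holds at 0, where both sides are 0, and it applies the real power only to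
   the nonnegative base x^2. *)
rewrite (_ : (fun x : R => x^-1) = fun x : R => x * (x ^+ 2) `^ (-1)).
  by apply: measurable_funM => //; apply: (measurableT_comp (measurable_powR _)).
apply/funext => x; rewrite powR_inv1 ?sqr_ge0//.
have [->|x0] := eqVneq x 0; first by rewrite invr0 mul0r.
by rewrite expr2 invfM mulrA divff// mul1r.
Qed.

Lemma measurable_funV d (T : measurableType d) (f : T -> R) :
  measurable_fun setT f -> measurable_fun setT (fun x => (f x)^-1).
Proof. exact: (measurableT_comp measurable_invr). Qed.

(* [bump t] is the Laplacian of [ln (1 + |t|^2)]; its dilations concentrate at
   the origin and make [ln |z|^2] a fundamental solution. *)
Definition bump (t : plane R) : R := 4 / (1 + t.1 ^+ 2 + t.2 ^+ 2) ^+ 2.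

Lemma bump_ge0 t : 0 <= bump t.
Proof. by rewrite /bump divr_ge0// sqr_ge0. Qed.

Lemma measurable_bump : measurable_fun setT bump.
Proof.
apply: measurable_funM => //; apply: measurable_funV; apply: measurable_funX.
by apply: measurable_funD; [apply: measurable_funD => //|]; apply: measurable_funX.
Qed.

Lemma integral_oneDsqrV : (\int[mu]_x ((oneDsqr x)^-1)%:E = pi%:E)%E.
Proof.
rewrite (@ge0_symfun_integralT _ (fun x => (oneDsqr x)^-1)).
- rewrite (_ : [set x | _] = `[0%R, +oo[%classic); last first.
    by apply/seteqP; split => x /=; rewrite in_itv/= andbT.
  rewrite integral0y_oneDsqr -EFinM; congr EFin; lra.
- by move=> x /=; rewrite invr_ge0; apply: le_trans ler01 (oneDsqr_ge1 x).
- exact: continuous_oneDsqrV.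
- by move=> x; rewrite /= /oneDsqr sqrrN.
Qed.

(** Expanding shows (1 + a) (1 + b) <= (1 + a + b)^2 for a, b >= 0. Under Tonelli's theorem the
    product bound splits into two integrals of 1 / (1 + x^2), each equal to pi. *)
Lemma bump_le t : bump t <= 4 * ((oneDsqr t.1)^-1 * (oneDsqr t.2)^-1).
Proof.
rewrite /bump /oneDsqr ler_pM2l// -invfM.
have := sqr_ge0 (t.1 : R); have := sqr_ge0 (t.2 : R).
move: (t.1 ^+ 2) (t.2 ^+ 2) => a b a0 b0.
rewrite lef_pV2 ?posrE; first by nra.
- by rewrite exprn_gt0//; lra.
- by apply: mulr_gt0; lra.
Qed.

Lemma integrable_bump : area.-integrable setT (EFin \o bump).
Proof.
have mg : measurable_fun setT (fun t : plane R =>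
   (4 * ((oneDsqr t.1)^-1 * (oneDsqr t.2)^-1))%:E).
  apply/measurable_EFinP; apply: measurable_funM => //.
  by apply: measurable_funM; apply: measurable_funV; rewrite /oneDsqr;
    apply: measurable_funD => //; apply: measurable_funX.
have V0 x : 0 <= (@oneDsqr R x)^-1.
  by rewrite invr_ge0; apply: le_trans ler01 (oneDsqr_ge1 x).
apply/integrableP; split; first by apply/measurable_EFinP; exact: measurable_bump.
apply: (@le_lt_trans _ _ (\int[area]_(t in setT)
   (4 * ((oneDsqr t.1)^-1 * (oneDsqr t.2)^-1))%:E)%E).
  apply: ge0_le_integral => //.
  - by apply: measurableT_comp => //; apply/measurable_EFinP; exact: measurable_bump.
  - by move=> t _; rewrite /= lee_fin ger0_norm ?bump_ge0// bump_le.
have m1 : measurable_fun setT (fun y : measurableTypeR R => ((oneDsqr y)^-1)%:E).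
  apply/measurable_EFinP; apply: measurable_funV; rewrite /oneDsqr.
  by apply: measurable_funD => //; apply: measurable_funX.
rewrite /area fubini_tonelli1//.
under eq_integral => x _.
  rewrite /fubini_F/=.
  under eq_integral do rewrite mulrA EFinM.
  rewrite ge0_integralZl//.
  rewrite integral_oneDsqrV muleC EFinM muleA.
  over.
rewrite ge0_integralZl//; last by rewrite lee_fin mulr_ge0// pi_ge0.
by rewrite integral_oneDsqrV -!EFinM ltry.
Qed.

(** In polar coordinates this is 4 pi. Its positivity is what later allows the factor in the Green
    representation to be cancelled. *)
Definition bump_mass : R := (\int[area]_t bump t)%R.

Lemma integral_bump : (\int[area]_t (bump t)%:E = bump_mass%:E)%E.
Proof.
rewrite /bump_mass /Rintegral fineK//; exact: integrable_fin_num integrable_bump.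
Qed.

Lemma area_setX (A B : set (measurableTypeR R)) : measurable A ->
  measurable B -> (area (A `*` B) = mu A * mu B)%E.
Proof. by move=> mA mB; exact: product_measure1E. Qed.

Lemma bump_mass_gt0 : 0 < bump_mass.
Proof.
rewrite -lte_fin -integral_bump.
pose Q : set (plane R) := `[0, 1]%classic `*` `[0, 1]%classic.
have mQ : measurable Q by apply: measurableX.
(* On the unit square 1 + x^2 + y^2 <= 3, so [bump] is at least 4 / 9 there. *)
apply: (@lt_le_trans _ _ (\int[area]_(t in Q) (4 / 9)%:E)%E).
  rewrite integral_cst// area_setX//= !lebesgue_measure_itv/=.
  by rewrite lte_fin ltr01 -EFinB subr0 -!EFinM lte_fin; lra.
apply: (@le_trans _ _ (\int[area]_(t in Q) (bump t)%:E)%E).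
  apply: ge0_le_integral => //.
  - by apply/measurable_EFinP; apply: measurable_funTS; exact: measurable_bump.
  move=> t /= [] /=; rewrite !in_itv/= /bump.
  move: (t.1 : R) (t.2 : R) => x y /andP[x0 x1] /andP[y0 y1].
  have h : 0 < 1 + x ^+ 2 + y ^+ 2 <= 3 by apply/andP; split; nra.
  rewrite lee_fin ler_pM2l// lef_pV2 ?posrE//; last first.
    by case/andP: h => h _; exact: exprn_gt0.
  by case/andP: h; nra.
apply: ge0_subset_integral => //.
- by apply/measurable_EFinP; exact: measurable_bump.
- by move=> t _; rewrite lee_fin bump_ge0.
Qed.

End planar_kernel.

(** * Green's identity for logarithms of quadratics on a box *)

Section green_one_variable.
Context {R : realType}.
Notation mu := (@lebesgue_measure R).

Lemma integral_is_derive (F f : R -> R) (p q : R) : p < q ->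
  (forall x, p <= x <= q -> is_derive x 1 F (f x)) ->
  (forall x, p <= x <= q -> {for x, continuous f}) ->
  (\int[mu]_(x in `[p, q]) (f x)%:E = (F q - F p)%:E)%E.
Proof.
move=> pq dF cf.
have cF x : p <= x <= q -> {for x, continuous F}.
  move=> /dF [dFx _]; apply: differentiable_continuous.
  exact/derivable1_diffP.
rewrite (@continuous_FTC2 _ f F)//.
- apply: continuous_in_subspaceT => x /set_mem/=; rewrite in_itv/=; exact: cf.
- split.
  + move=> x; rewrite in_itv/= => /andP[px xq].
    by have /dF[] : p <= x <= q by rewrite !ltW.
  + by apply: cvg_at_right_filter; apply: cF; rewrite lexx ltW.
  + by apply: cvg_at_left_filter; apply: cF; rewrite lexx ltW.
- move=> x; rewrite in_itv/= => /andP[px xq].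
  by rewrite derive1E; have /dF[_ ->] : p <= x <= q by rewrite !ltW.
Qed.

Definition dlog (s : {poly R}) (x : R) : R := s^`().[x] / s.[x].

Definition ddlog (s : {poly R}) (x : R) : R :=
  (s^`(2).[x] * s.[x] - s^`().[x] ^+ 2) / s.[x] ^+ 2.

Lemma is_derive_ln_poly (s : {poly R}) x : 0 < s.[x] ->
  is_derive x 1 (fun y => ln s.[y]) (dlog s x).
Proof.
move=> sx; rewrite /dlog mulrC; apply: (@is_derive1_comp _ (@ln R) (horner s)).
exact: is_derive1_ln.
Qed.

Lemma is_derive_dlog (s : {poly R}) x : 0 < s.[x] ->
  is_derive x 1 (dlog s) (ddlog s x).
Proof.
move=> sx; have s0 : s.[x] != 0 by rewrite gt_eqF.
rewrite (_ : ddlog s x =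
  s^`().[x] *: (- s.[x] ^- 2 *: s^`().[x]) + s.[x]^-1 *: s^`(2).[x]); last first.
  by rewrite /ddlog /GRing.scale/=; field.
exact: (@is_deriveM _ _ (horner s^`()) (fun y => s.[y]^-1)).
Qed.

Lemma continuous_ddlog (s : {poly R}) x : 0 < s.[x] ->
  {for x, continuous (ddlog s)}.
Proof.
move=> sx; have ch (t : {poly R}) : {for x, continuous (horner t)}.
  exact: continuous_horner.
apply: cvgM; last by apply: cvgV; rewrite ?sqrf_eq0 ?gt_eqF//; apply: cvgM; exact: ch.
by apply: cvgB; apply: cvgM; exact: ch.
Qed.

(* Fundamental theorem of calculus for [a' ln s - a (ln s)'], which vanishes at
   both ends. *)
Lemma integral_green (a s : {poly R}) (p q : R) : p < q ->
  a.[p] = 0 -> a.[q] = 0 -> a^`().[p] = 0 -> a^`().[q] = 0 ->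
  (forall x, p <= x <= q -> 0 < s.[x]) ->
  (\int[mu]_(x in `[p, q]) (a^`(2).[x] * ln s.[x])%:E =
   \int[mu]_(x in `[p, q]) (a.[x] * ddlog s x)%:E)%E.
Proof.
move=> pq ap aq a'p a'q s0.
have ch (t : {poly R}) x : {for x, continuous (horner t)}.
  exact: continuous_horner.
have c1 x : p <= x <= q -> {for x, continuous (fun x => a^`(2).[x] * ln s.[x])}.
  move=> /s0 sx; apply: cvgM; first exact: ch.
  apply: (@continuous_comp _ _ _ (horner s) (@ln R)); first exact: ch.
  exact: continuous_ln.
have c2 x : p <= x <= q -> {for x, continuous (fun x => a.[x] * ddlog s x)}.
  move=> /s0 sx; apply: cvgM; first exact: ch.
  exact: continuous_ddlog.
have it (f : R -> R) : (forall x, p <= x <= q -> {for x, continuous f}) ->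
    mu.-integrable `[p, q] (EFin \o f).
  move=> cf; apply: continuous_compact_integrable; first exact: segment_compact.
  by apply: continuous_in_subspaceT => x /set_mem/=; rewrite in_itv/=; exact: cf.
have i1 := it _ c1; have i2 := it _ c2.
have := integralB_EFin _ i1 i2.
rewrite -(fineK (integrable_fin_num _ i1))// -(fineK (integrable_fin_num _ i2))//.
move=> /(_ (measurable_itv _)); rewrite -EFinB => h.
suff e : (\int[mu]_(x in `[p, q])
    ((a^`(2).[x] * ln s.[x])%:E - (a.[x] * ddlog s x)%:E) = 0)%E.
  by move: h; rewrite e => -[] /esym/eqP; rewrite subr_eq0 => /eqP ->.
under eq_integral do rewrite -EFinB.
pose F (x : R) : R := a^`().[x] * ln s.[x] - a.[x] * dlog s x.
pose f (x : R) : R := a^`(2).[x] * ln s.[x] - a.[x] * ddlog s x.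
have dF (x : R) : p <= x <= q -> is_derive x 1 F (f x).
  move=> /s0 sx; rewrite /f.
  have d1 := is_derive_ln_poly sx; have d2 := is_derive_dlog sx.
  rewrite (_ : _ - _ =
    (a^`().[x] *: dlog s x + ln s.[x] *: a^`(2).[x]) -
     (a.[x] *: ddlog s x + dlog s x *: a^`().[x])); last first.
    by rewrite /GRing.scale/=; ring.
  by apply: is_deriveB; apply: is_deriveM.
rewrite (@integral_is_derive F f p q pq dF); last first.
  by move=> x xpq; apply: cvgB; [exact: c1|exact: c2].
by rewrite /F ap aq a'p a'q !mul0r subrr.
Qed.

End green_one_variable.

(** * Bounded measurable functions on a set of finite measure *)

Section bounded_measurable.
Context {R : realType} d (T : measurableType d).
Implicit Types (Q : set T) (f g : T -> R).

(** Measurability is global because the inverse and the logarithm are total functions; only the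
    bound needs [f] to stay away from 0, and only on [Q]. *)
Definition mbounded Q f :=
  measurable_fun setT f /\ exists C, forall z, Q z -> `|f z| <= C.

Lemma mboundedD Q f g :
  mbounded Q f -> mbounded Q g -> mbounded Q (fun z => f z + g z).
Proof.
move=> [mf [C fC]] [mg [D gD]]; split; first exact: measurable_funD.
exists (C + D) => z Qz; apply: le_trans (ler_normD _ _) _.
by rewrite lerD ?fC ?gD.
Qed.

Lemma mboundedM Q f g :
  mbounded Q f -> mbounded Q g -> mbounded Q (fun z => f z * g z).
Proof.
move=> [mf [C fC]] [mg [D gD]]; split; first exact: measurable_funM.
by exists (C * D) => z Qz; rewrite normrM ler_pM ?fC ?gD.
Qed.

Lemma mbounded_cst Q c : mbounded Q (fun=> c).
Proof. by split => //; exists `|c|. Qed.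

Lemma mboundedB Q f g :
  mbounded Q f -> mbounded Q g -> mbounded Q (fun z => f z - g z).
Proof.
move=> [mf [C fC]] [mg [D gD]]; split; first exact: measurable_funB.
exists (C + D) => z Qz; apply: le_trans (ler_normB _ _) _.
by rewrite lerD ?fC ?gD.
Qed.

Lemma mboundedV Q f m : 0 < m -> (forall z, Q z -> m <= f z) ->
  mbounded Q f -> mbounded Q (fun z => (f z)^-1).
Proof.
move=> m0 mf [mfT _]; split; first exact: measurable_funV.
exists m^-1 => z Qz; have fz := lt_le_trans m0 (mf _ Qz).
by rewrite gtr0_norm ?invr_gt0// lef_pV2 ?posrE// mf.
Qed.

Lemma mbounded_ln Q f m : 0 < m -> (forall z, Q z -> m <= f z) ->
  mbounded Q f -> mbounded Q (fun z => ln (f z)).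
Proof.
move=> m0 mf [mfT [C fC]]; split.
  by apply: measurableT_comp => //; exact: measurable_ln.
exists (`|ln m| + `|ln C|) => z Qz; have fz := lt_le_trans m0 (mf _ Qz).
have fzC : f z <= C by apply: le_trans (fC _ Qz); rewrite ler_norm.
have h1 : ln m <= ln (f z) by rewrite ler_ln ?posrE// mf.
have h2 : ln (f z) <= ln C by rewrite ler_ln ?posrE// (lt_le_trans fz).
have := ler_norm (- ln m); have := ler_norm (ln C).
have := normr_ge0 (ln m); have := normr_ge0 (ln C).
by rewrite normrN ler_norml => ? ? ? ?; apply/andP; split; lra.
Qed.

Lemma mbounded_horner Q f (s : {poly R}) :
  mbounded Q f -> mbounded Q (fun z => s.[f z]).
Proof.
move=> [mf [C fC]]; split.
  apply: measurableT_comp => //; apply: continuous_measurable_fun.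
  exact: continuous_horner.
exists (\sum_(i < size s) `|s`_i| * C ^+ i) => z Qz.
rewrite horner_coef; apply: le_trans (ler_norm_sum _ _ _) _.
apply: ler_sum => i _; rewrite normrM normrX ler_wpM2l//.
by apply: lerXn2r; rewrite ?nnegrE// ?fC// (le_trans _ (fC _ Qz)).
Qed.

Lemma integrable_mbounded (m : {measure set T -> \bar R}) Q f : measurable Q ->
  (m Q < +oo)%E -> mbounded Q f -> m.-integrable Q (EFin \o f).
Proof.
move=> mQ Qoo [mf [C fC]]; apply: measurable_bounded_integrable => //.
  exact: measurable_funTS.
exists C; split; first exact: num_real.
by move=> M CM z /= Qz; rewrite (le_trans (fC z Qz))// ltW.
Qed.

End bounded_measurable.

(** * Integration by parts on a box in the plane *)

Section green_box.
Context {R : realType}.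
Notation mu := (@lebesgue_measure R).
Implicit Types (I J : set (measurableTypeR R)) (f : plane R -> R).

(** The two orders of integration serve the two halves of the Laplacian: the y-derivatives are moved
    in an inner integral over y, the x-derivatives, by [integral_setX21], in an inner integral over
    x. *)
Lemma integral_setX12 I J f : measurable I -> measurable J ->
  area.-integrable (I `*` J) (EFin \o f) ->
  (\int[area]_(z in I `*` J) (f z)%:E =
   \int[mu]_(x in I) \int[mu]_(y in J) (f (x, y))%:E)%E.
Proof.
move=> mI mJ; have mIJ : measurable (I `*` J) by exact: measurableX.
move=> /(integrable_mkcond _ mIJ) ifIJ.
rewrite integral_mkcond [LHS](esym (integral12_prod_meas1 ifIJ)).
rewrite [RHS]integral_mkcond; apply: eq_integral => x _.
rewrite /fubini_F patchE; case: ifPn => xI.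
  rewrite [RHS]integral_mkcond; apply: eq_integral => y _.
  by rewrite !patchE in_setX xI.
by apply: integral0_eq => y _; rewrite patchE in_setX (negbTE xI).
Qed.

Lemma integral_setX21 I J f : measurable I -> measurable J ->
  area.-integrable (I `*` J) (EFin \o f) ->
  (\int[area]_(z in I `*` J) (f z)%:E =
   \int[mu]_(y in J) \int[mu]_(x in I) (f (x, y))%:E)%E.
Proof.
move=> mI mJ; have mIJ : measurable (I `*` J) by exact: measurableX.
move=> /(integrable_mkcond _ mIJ) ifIJ.
rewrite integral_mkcond [LHS](esym (integral21_prod_meas1 ifIJ)).
rewrite [RHS]integral_mkcond; apply: eq_integral => y _.
rewrite /fubini_G patchE; case: ifPn => yJ.
  rewrite [RHS]integral_mkcond; apply: eq_integral => x _.
  by rewrite !patchE in_setX yJ andbT.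
by apply: integral0_eq => x _; rewrite patchE in_setX (negbTE yJ) andbF.
Qed.

(** On every line parallel to an axis this is a polynomial, as [integral_green] requires. *)
Definition quad (al be ga de : R) (z : plane R) : R :=
  al * (z.1 ^+ 2 + z.2 ^+ 2) + be * z.1 + ga * z.2 + de.

Definition box (p q p' q' : R) : set (plane R) :=
  `[p, q]%classic `*` `[p', q']%classic.

Lemma measurable_box p q p' q' : measurable (box p q p' q').
Proof. by apply: measurableX. Qed.

Lemma area_box_lty p q p' q' : (area (box p q p' q') < +oo)%E.
Proof.
rewrite /box area_setX//= !lebesgue_measure_itv/=.
by do 2 case: ifP => _; rewrite -?EFinB -?EFinM ?mule0 ?mul0e ltry.
Qed.

Lemma mbounded_fst p q p' q' :
  mbounded (box p q p' q') (fun z : plane R => z.1 : R).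
Proof.
split; first exact: measurable_fst.
exists (`|p| + `|q|) => z [/=]; rewrite in_itv/= => /andP[pz zq] _.
have := ler_norm (- p); have := ler_norm q.
have := normr_ge0 p; have := normr_ge0 q.
by rewrite normrN ler_norml => ? ? ? ?; apply/andP; split; lra.
Qed.

Lemma mbounded_snd p q p' q' :
  mbounded (box p q p' q') (fun z : plane R => z.2 : R).
Proof.
split; first exact: measurable_snd.
exists (`|p'| + `|q'|) => z [/= _]; rewrite in_itv/= => /andP[pz zq].
have := ler_norm (- p'); have := ler_norm q'.
have := normr_ge0 p'; have := normr_ge0 q'.
by rewrite normrN ler_norml => ? ? ? ?; apply/andP; split; lra.
Qed.

Definition laplacian (a b : {poly R}) (z : plane R) : R :=
  a^`(2).[z.1] * b.[z.2] + a.[z.1] * b^`(2).[z.2].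

Definition flat_at (a : {poly R}) (x : R) := a.[x] = 0 /\ a^`().[x] = 0.

(* [4 al de - be^2 - ga^2] vanishes for [conj2], which is harmonic off its zero,
   and equals [4 e] for [dist2 + e]. *)
Lemma integral_laplacian_ln (a b : {poly R}) (p q p' q' : R)
    (al be ga de m : R) : p < q -> p' < q' ->
  flat_at a p -> flat_at a q -> flat_at b p' -> flat_at b q' ->
  0 < m -> (forall z, box p q p' q' z -> m <= quad al be ga de z) ->
  (\int[area]_(z in box p q p' q') (laplacian a b z * ln (quad al be ga de z))%:E
   = \int[area]_(z in box p q p' q') (a.[z.1] * b.[z.2] *
      ((4 * al * de - be ^+ 2 - ga ^+ 2) / quad al be ga de z ^+ 2))%:E)%E.
Proof.
move=> pq p'q' [ap a'p] [aq a'q] [bp b'p] [bq b'q] m0 mquad.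
set Q := box p q p' q'.
have mQ : measurable Q by exact: measurable_box.
have Qoo : (area Q < +oo)%E by exact: area_box_lty.
pose X (z : plane R) : R := z.1; pose Y (z : plane R) : R := z.2.
pose qd := quad al be ga de.
have bX : mbounded Q X := mbounded_fst p q p' q'.
have bY : mbounded Q Y := mbounded_snd p q p' q'.
have bq2 : mbounded Q qd.
  rewrite /qd /quad; apply: mboundedD; last exact: mbounded_cst.
  apply: mboundedD; last by apply: mboundedM => //; exact: mbounded_cst.
  apply: mboundedD; last by apply: mboundedM => //; exact: mbounded_cst.
  apply: mboundedM; first exact: mbounded_cst.
  by apply: mboundedD; exact: mboundedM.
have bqV : mbounded Q (fun z => (qd z ^+ 2)^-1).
  apply: (@mboundedV _ _ _ _ _ (m ^+ 2)); first exact: exprn_gt0.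
    move=> z Qz; apply: lerXn2r; rewrite ?nnegrE ?(ltW m0) ?mquad//.
    by rewrite (le_trans (ltW m0))// mquad.
  exact: mboundedM.
have bln : mbounded Q (fun z => ln (qd z)) by exact: (mbounded_ln m0 mquad bq2).
(* These are the second partial derivatives of ln [qd]. In the sum of their numerators the terms in
   z cancel and the discriminant remains. *)
pose Lxx (z : plane R) : R :=
  (2 * al * qd z - (2 * al * z.1 + be) ^+ 2) / qd z ^+ 2.
pose Lyy (z : plane R) : R :=
  (2 * al * qd z - (2 * al * z.2 + ga) ^+ 2) / qd z ^+ 2.
have bsq f c e : mbounded Q f -> mbounded Q (fun z => (2 * c * f z + e) ^+ 2).
  move=> bf; suff h : mbounded Q (fun z => 2 * c * f z + e) by exact: mboundedM.
  apply: mboundedD; last exact: mbounded_cst.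
  by apply: mboundedM => //; exact: mbounded_cst.
have bLxx : mbounded Q Lxx.
  apply: mboundedM => //; apply: mboundedB; last exact: (bsq X).
  by apply: mboundedM => //; exact: mbounded_cst.
have bLyy : mbounded Q Lyy.
  apply: mboundedM => //; apply: mboundedB; last exact: (bsq Y).
  by apply: mboundedM => //; exact: mbounded_cst.
have ba (s : {poly R}) : mbounded Q (fun z => s.[z.1]).
  exact: mbounded_horner bX.
have bb (s : {poly R}) : mbounded Q (fun z => s.[z.2]).
  exact: mbounded_horner bY.
have bi f : mbounded Q f -> area.-integrable Q (EFin \o f).
  exact: integrable_mbounded.
transitivity (\int[area]_(z in Q) (a^`(2).[z.1] * b.[z.2] * ln (qd z))%:E +
    \int[area]_(z in Q) (a.[z.1] * b^`(2).[z.2] * ln (qd z))%:E)%E.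
  rewrite -integralD_EFin//; last 2 first.
  - by apply: bi; do ![exact: ba|exact: bb|exact: bln|exact: bLxx|exact: bLyy|
      apply: mboundedM].
  - by apply: bi; do ![exact: ba|exact: bb|exact: bln|exact: bLxx|exact: bLyy|
      apply: mboundedM].
  by apply: eq_integral => z _; rewrite -EFinD -mulrDl.
transitivity (\int[area]_(z in Q) (a.[z.1] * b.[z.2] * Lxx z)%:E +
    \int[area]_(z in Q) (a.[z.1] * b.[z.2] * Lyy z)%:E)%E; last first.
  rewrite -integralD_EFin//; last 2 first.
  - by apply: bi; do ![exact: ba|exact: bb|exact: bln|exact: bLxx|exact: bLyy|
      apply: mboundedM].
  - by apply: bi; do ![exact: ba|exact: bb|exact: bln|exact: bLxx|exact: bLyy|
      apply: mboundedM].
  apply: eq_integral => z /set_mem Qz; rewrite -EFinD -mulrDr; congr (_ * _)%:E.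
  have := lt_le_trans m0 (mquad z Qz); rewrite /Lxx /Lyy -/qd => qz.
  rewrite -mulrDl; congr (_ / _); rewrite /qd /quad; ring.
congr (_ + _)%E.
- rewrite !integral_setX21//; last 2 first.
  - by apply: bi; do ![exact: ba|exact: bb|exact: bln|exact: bLxx|exact: bLyy|
      apply: mboundedM].
  - by apply: bi; do ![exact: ba|exact: bb|exact: bln|exact: bLxx|exact: bLyy|
      apply: mboundedM].
  apply: eq_integral => y /set_mem Jy /=.
  (* The restriction of [qd] to the horizontal line at height y. The constant b(y) is absorbed into
     the polynomial factor, which keeps its double zeros at p and q. *)
  pose s : {poly R} :=
    al%:P * 'X ^+ 2 + be%:P * 'X + (al * y ^+ 2 + ga * y + de)%:P.
  have sE x : s.[x] = qd (x, y).
    by rewrite /s /qd /quad !hornerE/=; ring.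
  have := @integral_green _ (b.[y] *: a) s p q pq.
  rewrite derivnZ derivZ !hornerZ ap aq a'p a'q !mulr0.
  move=> /(_ erefl erefl erefl erefl).
  move=> H; have s0 : forall x, p <= x <= q -> 0 < s.[x].
    move=> x xpq; rewrite sE; apply: lt_le_trans m0 _; apply: mquad.
    by split => //=; rewrite in_itv.
  move: H => /(_ s0) H.
  transitivity (\int[mu]_(x in `[p, q]) ((b.[y] *: a^`(2)).[x] * ln s.[x])%:E)%E.
    by apply: eq_integral => x _; rewrite sE hornerZ (mulrC b.[y]).
  rewrite H; apply: eq_integral => x _.
  rewrite hornerZ (mulrC b.[y]) /ddlog /Lxx sE; congr (_ * (_ / _))%:E.
  by rewrite /s !derivnS !poly.derivE !hornerE/=; ring.
- rewrite !integral_setX12//; last 2 first.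
  - by apply: bi; do ![exact: ba|exact: bb|exact: bln|exact: bLxx|exact: bLyy|
      apply: mboundedM].
  - by apply: bi; do ![exact: ba|exact: bb|exact: bln|exact: bLxx|exact: bLyy|
      apply: mboundedM].
  apply: eq_integral => x /set_mem Ix /=.
  pose s : {poly R} :=
    al%:P * 'X ^+ 2 + ga%:P * 'X + (al * x ^+ 2 + be * x + de)%:P.
  have sE y : s.[y] = qd (x, y).
    by rewrite /s /qd /quad !hornerE/=; ring.
  have := @integral_green _ (a.[x] *: b) s p' q' p'q'.
  rewrite derivnZ derivZ !hornerZ bp bq b'p b'q !mulr0.
  move=> /(_ erefl erefl erefl erefl).
  move=> H; have s0 : forall y, p' <= y <= q' -> 0 < s.[y].
    move=> y ypq; rewrite sE; apply: lt_le_trans m0 _; apply: mquad.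
    by split => //=; rewrite in_itv.
  move: H => /(_ s0) H.
  transitivity (\int[mu]_(y in `[p', q']) ((a.[x] *: b^`(2)).[y] * ln s.[y])%:E)%E.
    by apply: eq_integral => y _; rewrite sE hornerZ.
  rewrite H; apply: eq_integral => y _.
  rewrite hornerZ /ddlog /Lyy sE; congr (_ * (_ / _))%:E.
  by rewrite /s !derivnS !poly.derivE !hornerE/=; ring.
Qed.

End green_box.

(** * The logarithmic singularity *)

Section log_singularity.
Context {R : realType}.
Notation mu := (@lebesgue_measure R).

(* The value at [0] is [+oo], so that [logsing (z.1 - w.1)] dominates
   [|ln |z - w|^2|] everywhere and not just almost everywhere. *)
Definition logsing (t : R) : \bar R :=
  if t == 0 then +oo%E else (ln 5 - ln (t ^+ 2))%:E.

(** On [-2, 2] one has t^2 + 1 / (n + 1) <= 5, so the constant ln 5 makes this nonnegative; it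
    increases with n to [logsing], as monotone convergence requires. *)
Let reglog (n : nat) (t : R) : R := ln 5 - ln (t ^+ 2 + n.+1%:R^-1).

Let nV_gt0 (n : nat) : 0 < n.+1%:R^-1 :> R.
Proof. by rewrite invr_gt0. Qed.

Let nV_le1 (n : nat) : n.+1%:R^-1 <= 1 :> R.
Proof. by rewrite invf_le1// ler1n. Qed.

Let sqrDV_gt0 (t : R) n : 0 < t ^+ 2 + n.+1%:R^-1.
Proof. by rewrite ltr_wpDl ?sqr_ge0. Qed.

Lemma cvg_ln_sqrD (t : R) : t != 0 ->
  ln (t ^+ 2 + n.+1%:R^-1) @[n --> \oo] --> ln (t ^+ 2).
Proof.
move=> t0; have c : {for t ^+ 2, continuous (@ln R)}.
  by apply: continuous_ln; rewrite exprn_even_gt0.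
have h : t ^+ 2 + n.+1%:R^-1 @[n --> \oo] --> t ^+ 2.
  rewrite -[X in _ --> X]addr0.
  by apply: cvgD; [exact: cvg_cst|exact: cvg_harmonic].
exact: (cvg_comp _ _ h c).
Qed.

Let cvg_reglog (t : R) : (reglog n t)%:E @[n --> \oo] --> logsing t.
Proof.
rewrite /logsing; case: ifPn => [/eqP ->|t0].
  apply/cvgeryP/cvgryPge => A; rewrite /reglog expr0n/=.
  near=> n; rewrite add0r lnV ?posrE// opprK.
  apply: ler_wpDl; first by rewrite ln_ge0// ler1n.
  rewrite -[leLHS]expRK ler_ln ?posrE ?expR_gt0//.
  apply: (@le_trans _ _ n%:R); last by rewrite ler_nat.
  by apply/ltW; near: n; exact: nbhs_infty_gtr.
apply/fine_cvgP; split; first by near=> n.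
by apply: cvgB; [exact: cvg_cst|exact: cvg_ln_sqrD].
Unshelve. all: by end_near. Qed.

Let reglog_ge0 n t : t \in `[(-2)%R, 2%R] -> 0 <= reglog n t.
Proof.
rewrite in_itv/= => /andP[t1 t2]; rewrite subr_ge0 ler_ln ?posrE//.
have : t ^+ 2 <= 4 by nra.
by have := nV_le1 n; move: (n.+1%:R^-1) => e; lra.
Qed.

Let continuous_ln_sqrD n : continuous (fun t : R => ln (t ^+ 2 + n.+1%:R^-1)).
Proof.
move=> t; apply: (@continuous_comp _ _ _ (fun t : R => t ^+ 2 + n.+1%:R^-1) (@ln R)).
  by apply: cvgD; [exact: exprn_continuous|exact: cvg_cst].
exact: continuous_ln.
Qed.

Let measurable_reglog n : measurable_fun [set: measurableTypeR R] (reglog n).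
Proof.
apply: measurable_funB => //; apply: continuous_measurable_fun.
exact: continuous_ln_sqrD.
Qed.

Lemma measurable_logsing : measurable_fun [set: measurableTypeR R] logsing.
Proof.
apply: (emeasurable_fun_cvg (fun n t => (reglog n t)%:E)).
  by move=> n; apply/measurable_EFinP; exact: measurable_reglog.
by move=> t _; exact: cvg_reglog.
Qed.

(* The bound comes from [(ln 5 + 2) t - t ln (t^2 + e)], whose derivative
   exceeds [reglog] by [2 e / (t^2 + e)]. *)
Let integral_reglog n :
  (\int[mu]_(t in `[(-2)%R, 2%R]) (reglog n t)%:E <= (4 * ln 5 + 8)%:E)%E.
Proof.
set e : R := n.+1%:R^-1.
pose s : {poly R} := 'X ^+ 2 + e%:P.
have sE t : s.[t] = t ^+ 2 + e by rewrite /s !hornerE.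
have s0 t : 0 < s.[t] by rewrite sE; exact: sqrDV_gt0.
pose c : {poly R} := (ln 5 + 2)%:P * 'X.
pose F (t : R) := c.[t] - ('X : {poly R}).[t] * ln s.[t].
pose f (t : R) := ln 5 + 2 - (ln s.[t] + t * dlog s t).
have fE t : f t = ln 5 - ln s.[t] + 2 * e / s.[t].
  have := s0 t; rewrite /f /dlog /s !poly.derivE !hornerE/= => ?.
  by field; rewrite gt_eqF.
have dF (t : R) : -2 <= t <= 2 -> is_derive t 1 F (f t).
  move=> _; have d1 := is_derive_ln_poly (s0 t).
  rewrite (_ : f t = c^`().[t] - (('X : {poly R}).[t] *: dlog s t +
      ln s.[t] *: ('X : {poly R})^`().[t])).
    by apply: is_deriveB; apply: is_deriveM.
  have c't : c^`().[t] = ln 5 + 2 by rewrite /c !poly.derivE !hornerE.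
  by rewrite c't !poly.derivE hornerX hornerC /f /GRing.scale/=; ring.
have cf : continuous f.
  move=> t; have -> : f = fun t => ln 5 - ln s.[t] + 2 * e / s.[t] by apply/funext.
  have ch : {for t, continuous (horner s)} by exact: continuous_horner.
  apply: cvgD; last by apply: cvgM; [exact: cvg_cst|apply: cvgV; rewrite ?gt_eqF].
  apply: cvgB; first exact: cvg_cst.
  by apply: (@continuous_comp _ _ _ (horner s) (@ln R)) => //; exact: continuous_ln.
have h22 : -2 < 2 :> R by lra.
apply: (@le_trans _ _ (\int[mu]_(t in `[(-2)%R, 2%R]) (f t)%:E)%E).
  apply: ge0_le_integral => //.
  - by move=> t tI; rewrite lee_fin reglog_ge0.
  - by apply/measurable_EFinP; apply: measurable_funTS; exact: measurable_reglog.
  - apply/measurable_EFinP; apply: measurable_funTS.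
    exact: continuous_measurable_fun.
  - move=> t _; rewrite lee_fin fE /reglog sE lerDl.
    apply: divr_ge0; first by apply: mulr_ge0 => //; apply/ltW; exact: nV_gt0.
    by apply/ltW; exact: sqrDV_gt0.
rewrite (integral_is_derive h22 dF (fun t _ => cf t)) lee_fin /F !sE sqrrN.
rewrite !hornerM !hornerX !hornerC.
have : 0 <= ln (2 ^+ 2 + e) by rewrite ln_ge0//; have := nV_gt0 n; rewrite -/e; lra.
lra.
Qed.

(** The interval [-2, 2] contains all differences of first coordinates of points of the disk.
    Extended by 0 the function is nonnegative and integrable on the whole line, so it can be
    translated freely. *)
Definition logsing22 : R -> \bar R := logsing \_ `[(-2)%R, 2%R].

Lemma logsing22_ge0 t : (0 <= logsing22 t)%E.
Proof.
rewrite /logsing22 patchE; case: ifPn => // /set_mem/=.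
rewrite /logsing in_itv/= => /andP[t1 t2]; case: ifPn => // t0.
rewrite lee_fin subr_ge0 ler_ln ?posrE// ?exprn_even_gt0//; nra.
Qed.

Lemma measurable_logsing22 : measurable_fun [set: measurableTypeR R] logsing22.
Proof.
apply/(measurable_restrictT _ _).1 => //.
exact: measurable_funTS measurable_logsing.
Qed.

Lemma integral_logsing22 : (\int[mu]_t logsing22 t <= (4 * ln 5 + 8)%:E)%E.
Proof.
rewrite -integral_mkcond.
have := @cvg_monotone_convergence _ _ R mu `[(-2)%R, 2%R]%classic (measurable_itv _)
  (fun n t => (reglog n t)%:E).
have mreg n : measurable_fun `[(-2:R)%R, 2%R] (fun t => (reglog n t)%:E).
  by apply/measurable_EFinP; apply: measurable_funTS; exact: measurable_reglog.
move=> /(_ mreg).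
have r0 n (t : R) : `[(-2)%R, 2%R]%classic t -> (0 <= (reglog n t)%:E)%E.
  by move=> /= tI; rewrite lee_fin reglog_ge0.
move=> /(_ r0).
have nd (t : R) : `[(-2)%R, 2%R]%classic t ->
    {homo (fun n => (reglog n t)%:E) : n m / (n <= m)%N >-> (n <= m)%E}.
  move=> _ n m nm; rewrite lee_fin /reglog lerD2l lerN2 ler_ln ?posrE//.
  by rewrite lerD2l lef_pV2 ?posrE// ler_nat.
move=> /(_ nd) h.
rewrite (_ : (\int[_]_(t in _) _)%E =
    limn (fun n => \int[mu]_(x in `[(-2)%R, 2%R]) (reglog n x)%:E)%E); last first.
  rewrite (cvg_lim _ h)//; apply: eq_integral => t _.
  by rewrite (cvg_lim _ (@cvg_reglog t)).
apply: lime_le; first by apply/cvg_ex; eexists; exact: h.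
by apply: nearW => n; exact: integral_reglog.
Qed.

(** The box is enlarged to a full horizontal strip. The integral over x is then invariant under
    translation by [u], and the bound does not depend on [u]. *)
Lemma integral_box_logsing22 (p q p' q' u : R) :
  (\int[area]_(z in box p q p' q') logsing22 (z.1 - u) <=
   (4 * ln 5 + 8)%:E * mu `[p', q'])%E.
Proof.
pose J : set (measurableTypeR R) := `[p', q']%classic.
pose f (z : plane R) := logsing22 (z.1 - u).
have m1 : measurable_fun [set: measurableTypeR R] (fun x => logsing22 (x - u)).
  apply: (measurableT_comp measurable_logsing22).
  exact: measurable_funB.
have mf : measurable_fun setT f.
  exact: (measurableT_comp m1 (@measurable_fst _ _ _ _)).
have mJ : measurable J by exact: measurable_itv.
have mTJ : measurable (setT `*` J : set (plane R)) by exact: measurableX.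
apply: (@le_trans _ _ (\int[area]_(z in setT `*` J) f z)%E).
  apply: ge0_subset_integral => //.
  - exact: measurable_box.
  - exact: measurable_funTS.
  - by move=> z _; exact: logsing22_ge0.
  - by move=> z [_ ?]; split.
rewrite integral_mkcond.
rewrite [leLHS](fubini_tonelli2 (m1 := mu) (m2 := mu) (f \_ (setT `*` J)))//; first last.
- by move=> z; rewrite patchE; case: ifPn => // _; exact: logsing22_ge0.
- by apply/(measurable_restrictT _ _).1 => //; exact: measurable_funTS.
have e : (\int[mu]_x logsing22 (x - u) = \int[mu]_x logsing22 x)%E.
  rewrite [RHS](@ge0_integral_affine R 1 (- u))//; last 2 first.
  - exact: measurable_logsing22.
  - exact: logsing22_ge0.
  by rewrite mul1e; apply: eq_integral => x _; rewrite mul1r addrC.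
rewrite (_ : (fun y => _) = (cst (\int[mu]_x logsing22 x)) \_ J)%E; last first.
  apply/funext => y; rewrite patchE /fubini_G; case: ifPn => yJ.
    by rewrite -e; apply: eq_integral => x _; rewrite patchE in_setX in_setT yJ.
  by apply: integral0_eq => x _; rewrite patchE in_setX (negbTE yJ) andbF.
rewrite -integral_mkcond integral_cst//=.
by apply: lee_wpmul2r => //; exact: integral_logsing22.
Qed.

End log_singularity.

(** * The Green function of the disk *)

Section hyperbolic_green_function.
Context {R : realType}.
Implicit Types z w : plane R.

Definition dist2 z w : R := (z.1 - w.1) ^+ 2 + (z.2 - w.2) ^+ 2.

(* The squared modulus of [1 - conj z * w]. *)
Definition conj2 z w : R :=
  (1 - z.1 * w.1 - z.2 * w.2) ^+ 2 + (z.1 * w.2 - z.2 * w.1) ^+ 2.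

Lemma pseudo_hyp_distE z w :
  pseudo_hyp_dist z w = Num.sqrt (dist2 z w) / Num.sqrt (conj2 z w).
Proof.
rewrite /pseudo_hyp_dist normcM normcV /normc /cplx /dist2 /conj2/=.
by congr (Num.sqrt _ / Num.sqrt _); simpc; rewrite /=; ring.
Qed.

Lemma dist2_ge0 z w : 0 <= dist2 z w.
Proof. by rewrite addr_ge0 ?sqr_ge0. Qed.

(** This gives the positivity of [conj2] and the inequality [dist2 <= conj2] on the disk, and later
    the formula for 1 - t^2, with t the pseudo-hyperbolic distance. *)
Lemma conj2E z w : conj2 z w =
  dist2 z w + (1 - (z.1 ^+ 2 + z.2 ^+ 2)) * (1 - (w.1 ^+ 2 + w.2 ^+ 2)).
Proof. by rewrite /conj2 /dist2; ring. Qed.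

Lemma conj2_gt0 z w : unit_disk z -> unit_disk w -> 0 < conj2 z w.
Proof.
move=> /unit_diskE z1 /unit_diskE w1; rewrite conj2E ltr_wpDl ?dist2_ge0//.
by rewrite mulr_gt0 ?subr_gt0.
Qed.

Lemma dist2_eq0 z w : dist2 z w = 0 -> z = w.
Proof.
move/eqP; rewrite paddr_eq0 ?sqr_ge0// !sqrf_eq0 !subr_eq0.
by case: z w => [? ?] [? ?] /= /andP[/eqP -> /eqP ->].
Qed.

Definition hyp_green z w : R := ln (1 / pseudo_hyp_dist z w).

Lemma hyp_greenE z w : unit_disk z -> unit_disk w -> z <> w ->
  hyp_green z w = 2^-1 * (ln (conj2 z w) - ln (dist2 z w)).
Proof.
move=> zD wD zw; have c0 := conj2_gt0 zD wD.
have d0 : 0 < dist2 z w.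
  by rewrite lt_neqAle dist2_ge0 eq_sym andbT; apply/eqP => /dist2_eq0.
have sq x : 0 < x -> ln (Num.sqrt x) = 2^-1 * ln x.
  move=> x0; have -> : ln x = 2 * ln (Num.sqrt x).
    by rewrite mulr_natl -lnXn ?sqrtr_gt0// sqr_sqrtr// ltW.
  by rewrite mulKf.
rewrite /hyp_green pseudo_hyp_distE mul1r invf_div ln_div ?posrE ?sqrtr_gt0//.
by rewrite !sq//; ring.
Qed.

Lemma dist2_le4 z w : unit_disk z -> unit_disk w -> dist2 z w <= 4.
Proof.
move=> /unit_diskE + /unit_diskE; rewrite /dist2.
move: (z.1 : R) (z.2 : R) (w.1 : R) (w.2 : R) => x y u v h1 h2.
(* Parallelogram law: |z - w|^2 + |z + w|^2 = 2 |z|^2 + 2 |w|^2 < 4. *)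
have := sqr_ge0 (x + u); have := sqr_ge0 (y + v); nra.
Qed.

Lemma conj2_le5 z w : unit_disk z -> unit_disk w -> conj2 z w <= 5.
Proof.
move=> zD wD; have := dist2_le4 zD wD; rewrite conj2E.
move: zD wD => /unit_diskE + /unit_diskE.
have : 0 <= (z.1 : R) ^+ 2 + (z.2 : R) ^+ 2 by rewrite addr_ge0 ?sqr_ge0.
have : 0 <= (w.1 : R) ^+ 2 + (w.2 : R) ^+ 2 by rewrite addr_ge0 ?sqr_ge0.
move: (dist2 z w) ((z.1 : R) ^+ 2 + (z.2 : R) ^+ 2) => d A.
move: ((w.1 : R) ^+ 2 + (w.2 : R) ^+ 2) => B; nra.
Qed.

(** With t the difference of the first coordinates, t^2 <= |z - w|^2 <= s <= 5, so ln s lies between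
    ln (t^2) and ln 5. The constant 5 covers both |z - w|^2 + e with e <= 1 and |1 - conj z w|^2. *)
Lemma ln_le_logsing22 z w (s : R) : unit_disk z -> unit_disk w ->
  dist2 z w <= s -> s <= 5 ->
  (`|ln s|%:E <= logsing22 (z.1 - w.1)%R + (ln 5)%:E)%E.
Proof.
move=> zD wD ds s5; set t : R := z.1 - w.1.
have tI : t \in `[-2, 2].
  rewrite in_itv/= /t; move: zD wD => /unit_diskE + /unit_diskE.
  move: (z.1 : R) (z.2 : R) (w.1 : R) (w.2 : R) => x y u v h1 h2.
  have x1 : -1 <= x <= 1 by apply/andP; split; nra.
  have u1 : -1 <= u <= 1 by apply/andP; split; nra.
  by case/andP: x1 => ? ?; case/andP: u1 => ? ?; apply/andP; split; lra.
have tds : t ^+ 2 <= s by apply: le_trans ds; rewrite lerDl sqr_ge0.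
rewrite /logsing22 patchE mem_set//= /logsing; case: ifPn => [_|t0].
  by rewrite addye// leey.
have t2 : 0 < t ^+ 2 by rewrite exprn_even_gt0.
have t4 : t ^+ 2 <= 5 by move: tI; rewrite in_itv/= => /andP[]; nra.
have h1 : ln s <= ln 5 by rewrite ler_ln ?posrE// (lt_le_trans t2).
have h2 : ln (t ^+ 2) <= ln s by rewrite ler_ln ?posrE// (lt_le_trans t2).
have h3 : ln (t ^+ 2) <= ln 5 by rewrite ler_ln ?posrE.
have h4 : 0 <= ln 5 :> R by rewrite ln_ge0// ler1n.
by rewrite -EFinD lee_fin ler_norml; apply/andP; split; lra.
Qed.

Lemma ln_dist2_le z w (e : R) : unit_disk z -> unit_disk w -> 0 <= e <= 1 ->
  (`|ln (dist2 z w + e)|%:E <= logsing22 (z.1 - w.1)%R + (ln 5)%:E)%E.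
Proof.
move=> zD wD /andP[e0 e1]; apply: ln_le_logsing22 => //; first by rewrite lerDl.
by have := dist2_le4 zD wD; lra.
Qed.

Lemma hyp_green_le z w : unit_disk z -> unit_disk w ->
  (`|hyp_green z w|%:E <= logsing22 (z.1 - w.1)%R + (ln 5)%:E)%E.
Proof.
move=> zD wD; have [zw|zw] := pselect (z = w).
  (* On the diagonal the conventions 1 / 0 = 0 and ln 0 = 0 make the kernel 0. *)
  rewrite -zw /hyp_green /pseudo_hyp_dist subrr mul0r normc0 invr0 mulr0 ln0//.
  by rewrite normr0 adde_ge0 ?logsing22_ge0// lee_fin ln_ge0// ler1n.
have d5 : dist2 z w <= 5 by have := dist2_le4 zD wD; lra.
have h1 := ln_le_logsing22 zD wD (lexx _) d5.
have dc : dist2 z w <= conj2 z w.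
  rewrite conj2E lerDl mulr_ge0// subr_ge0; exact/ltW/unit_diskE.
have h2 := ln_le_logsing22 zD wD dc (conj2_le5 zD wD).
rewrite hyp_greenE//; move: h1 h2.
case: (logsing22 _ + _)%E => [r|_ _|//]; last exact: leey.
rewrite !lee_fin normrM => h1 h2.
have -> : `|2^-1| = 2^-1 :> R by rewrite ger0_norm// invr_ge0.
have := ler_normB (ln (conj2 z w)) (ln (dist2 z w)); lra.
Qed.

Lemma measurable_hyp_green :
  measurable_fun setT (fun zw : plane R * plane R => hyp_green zw.1 zw.2).
Proof.
have m11 : measurable_fun setT (fun zw : plane R * plane R => zw.1.1 : R).
  exact: (measurableT_comp (@measurable_fst _ _ _ _) (@measurable_fst _ _ _ _)).
have m12 : measurable_fun setT (fun zw : plane R * plane R => zw.1.2 : R).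
  exact: (measurableT_comp (@measurable_snd _ _ _ _) (@measurable_fst _ _ _ _)).
have m21 : measurable_fun setT (fun zw : plane R * plane R => zw.2.1 : R).
  exact: (measurableT_comp (@measurable_fst _ _ _ _) (@measurable_snd _ _ _ _)).
have m22 : measurable_fun setT (fun zw : plane R * plane R => zw.2.2 : R).
  exact: (measurableT_comp (@measurable_snd _ _ _ _) (@measurable_snd _ _ _ _)).
have msqrt : measurable_fun setT (@Num.sqrt R).
  by apply: continuous_measurable_fun; exact: sqrt_continuous.
rewrite /hyp_green; under eq_fun do rewrite pseudo_hyp_distE.
apply: (measurableT_comp (@measurable_ln R)).
apply: measurable_funM => //; apply: measurable_funV; apply: measurable_funM.
  apply: (measurableT_comp msqrt); rewrite /dist2.
  by apply: measurable_funD; apply: measurable_funX; apply: measurable_funB.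
apply: measurable_funV; apply: (measurableT_comp msqrt); rewrite /conj2.
apply: measurable_funD; apply: measurable_funX.
  apply: measurable_funB; last exact: measurable_funM.
  by apply: measurable_funB => //; exact: measurable_funM.
by apply: measurable_funB; exact: measurable_funM.
Qed.

End hyperbolic_green_function.

(** * The Green representation of test functions on a box *)

Section approximate_identity.
Context {R : realType}.
Implicit Types (a b : {poly R}) (z w : plane R).

Definition cutoff a (p q : R) : R -> R := (horner a) \_ `[p, q].

(** Because [a] vanishes at both ends, extension by 0 agrees with clamping the argument to [p, q],
    and clamping is continuous. *)
Lemma cutoffE a p q x : p < q -> a.[p] = 0 -> a.[q] = 0 ->
  cutoff a p q x = a.[Num.max p (Num.min q x)].
Proof.
move=> pq ap aq; rewrite /cutoff patchE; case: ifPn => [/set_mem/=|].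
  by rewrite in_itv/= => /andP[px xq]; rewrite (min_idPr xq) (max_idPr px).
rewrite notin_setE/= in_itv/= => /negP; rewrite negb_and -!ltNge => /orP[xp|qx].
  have xq : x <= q by rewrite ltW// (lt_trans xp).
  by rewrite (min_idPr xq) (max_idPl (ltW xp)) ap.
by rewrite (min_idPl (ltW qx)) (max_idPr (ltW pq)) aq.
Qed.

Lemma continuous_cutoff a p q : p < q -> a.[p] = 0 -> a.[q] = 0 ->
  continuous (cutoff a p q).
Proof.
move=> pq ap aq x.
have -> : cutoff a p q = fun x => a.[Num.max p (Num.min q x)].
  by apply/funext => y; exact: cutoffE.
apply: (@continuous_comp _ _ _ (fun x => Num.max p (Num.min q x)) (horner a)).
  apply: (@continuous_max _ _ (cst p) (fun x => Num.min q x)).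
    exact: cst_continuous.
  by apply: (@continuous_min _ _ (cst q) id); [exact: cst_continuous|].
exact: continuous_horner.
Qed.

Lemma cutoff_le a p q : exists2 C, 0 <= C & forall x, `|cutoff a p q x| <= C.
Proof.
have [C aC] : exists C, forall x, p <= x <= q -> `|a.[x]| <= C.
  (* The segment [p, q] is viewed as the degenerate box [p, q] x [0, 0]. *)
  have [_ [C hC]] := mbounded_horner a (mbounded_fst p q 0 0).
  by exists C => x xpq; apply: (hC (x, 0)); split; rewrite /= in_itv//= lexx.
exists `|C| => // x; rewrite /cutoff patchE; case: ifPn => [/set_mem/=|_].
  by rewrite in_itv/= => /aC h; rewrite (le_trans h)// ler_norm.
by rewrite normr0.
Qed.

Let s_ (n : nat) : R := n.+1%:R^-1.

Let s_gt0 n : 0 < s_ n.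
Proof. by rewrite invr_gt0. Qed.

(** Rescaling around w by 1 / (n + 1) leaves the fixed weight [bump] times the cutoffs at w + t / (n
    + 1). These are bounded and continuous, so dominated convergence applies at every w, also on the
    boundary of the box. The signs of [a] and [b] put the integrand within reach of the change of
    variables for nonnegative functions. *)
Lemma cvg_integral_poisson a b (p q p' q' : R) w : p < q -> p' < q' ->
  a.[p] = 0 -> a.[q] = 0 -> b.[p'] = 0 -> b.[q'] = 0 ->
  (forall x, p <= x <= q -> 0 <= a.[x]) ->
  (forall y, p' <= y <= q' -> 0 <= b.[y]) ->
  (\int[area]_(z in box p q p' q') (a.[z.1] * b.[z.2] *
    (4 * n.+1%:R^-1 ^+ 2 / (dist2 z w + n.+1%:R^-1 ^+ 2) ^+ 2))%:E)%E @[n --> \oo] -->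
  (cutoff a p q w.1 * cutoff b p' q' w.2 * bump_mass)%:E.
Proof.
move=> pq p'q' ap aq bp bq a0 b0.
pose F (z : plane R) := cutoff a p q z.1 * cutoff b p' q' z.2.
have ca := continuous_cutoff pq ap aq; have cb := continuous_cutoff p'q' bp bq.
have mF : measurable_fun setT F.
  apply: measurable_funM.
    exact: (measurableT_comp (continuous_measurable_fun ca) (@measurable_fst _ _ _ _)).
  exact: (measurableT_comp (continuous_measurable_fun cb) (@measurable_snd _ _ _ _)).
have F0 z : 0 <= F z.
  rewrite /F /cutoff !patchE; apply: mulr_ge0; case: ifPn => // /set_mem/=.
    by rewrite in_itv/= => /a0.
  by rewrite in_itv/= => /b0.
pose G n (t : plane R) := F (w.1 + s_ n * t.1, w.2 + s_ n * t.2) * bump t.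
have mG n : measurable_fun setT (fun t => (G n t)%:E).
  apply/measurable_EFinP; apply: measurable_funM; last exact: measurable_bump.
  apply: (measurableT_comp mF); apply: measurable_fun_pair => /=.
    by apply: measurable_funD => //; apply: measurable_funM.
  by apply: measurable_funD => //; apply: measurable_funM.
rewrite (_ : (fun n => _) = (fun n => \int[area]_t (G n t)%:E))%E; last first.
  apply/funext => n; rewrite integral_mkcond.
  pose H (z : plane R) := (F z * (4 * s_ n ^+ 2 / (dist2 z w + s_ n ^+ 2) ^+ 2))%:E.
  transitivity (\int[area]_z H z)%E.
    apply: eq_integral => z _; rewrite patchE /H /F /box in_setX /cutoff !patchE.
    by case: (_ \in _) => //=; [case: (_ \in _); rewrite ?mulr0 ?mul0r|rewrite !mul0r].
  have H0 z : (0 <= H z)%E.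
    rewrite lee_fin; apply: mulr_ge0 => //; apply: divr_ge0; last exact: sqr_ge0.
    by rewrite mulr_ge0// sqr_ge0.
  have mH : measurable_fun setT H.
    apply/measurable_EFinP; apply: measurable_funM => //.
    apply: measurable_funM => //; apply: measurable_funV; apply: measurable_funX.
    apply: measurable_funD => //; rewrite /dist2.
    by apply: measurable_funD; apply: measurable_funX; apply: measurable_funB.
  rewrite (ge0_integral_area_affine w (s_gt0 n) mH H0).
  rewrite -ge0_integralZl//; last by rewrite lee_fin sqr_ge0.
    apply: eq_integral => t _; rewrite -EFinM /H /G /bump; congr EFin.
    rewrite mulrCA; congr (_ * _); rewrite /dist2/=.
    have := s_gt0 n; move: (s_ n) (t.1 : R) (t.2 : R) (w.1 : R) (w.2 : R).
    move=> s x y u v s0.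
    have e : (u + s * x - u) ^+ 2 + (v + s * y - v) ^+ 2 + s ^+ 2 =
        s ^+ 2 * (1 + x ^+ 2 + y ^+ 2) by ring.
    have d0 : 0 < 1 + x ^+ 2 + y ^+ 2.
      by rewrite -addrA ltr_pwDl// addr_ge0// sqr_ge0.
    by rewrite e; field; rewrite !gt_eqF.
  apply: (measurableT_comp mH); apply: measurable_fun_pair => /=.
    by apply: measurable_funD => //; apply: measurable_funM.
  by apply: measurable_funD => //; apply: measurable_funM.
have -> : ((F w * bump_mass)%:E = \int[area]_t (F w * bump t)%:E)%E.
  under eq_integral do rewrite EFinM.
  by rewrite integralZl//; [rewrite integral_bump|exact: integrable_bump].
have [Ca Ca0 aC] := cutoff_le a p q; have [Cb Cb0 bC] := cutoff_le b p' q'.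
have mb : measurable_fun setT (fun t => (F w * bump t)%:E).
  by apply/measurable_EFinP; apply: measurable_funM => //; exact: measurable_bump.
have cv : {ae area, forall t, setT t ->
    (G n t)%:E @[n --> \oo] --> (F w * bump t)%:E}.
  apply: aeW => t _; apply: cvg_EFin; first by near=> n.
  apply: cvgM; last exact: cvg_cst.
  have ct (u x : R) : u + s_ n * x @[n --> \oo] --> u.
    rewrite -[X in _ --> X]addr0 -[X in _ --> _ + X](mul0r x).
    apply: cvgD; first exact: cvg_cst.
    by apply: cvgM; [exact: cvg_harmonic|exact: cvg_cst].
  apply: cvgM.
    exact: (cvg_comp _ _ (ct w.1 t.1) (ca w.1)).
  exact: (cvg_comp _ _ (ct w.2 t.2) (cb w.2)).
have ib : area.-integrable setT (fun t => (Ca * Cb * bump t)%:E).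
  under eq_fun do rewrite EFinM.
  by apply: integrableZl => //; exact: integrable_bump.
have le : {ae area, forall t n, setT t ->
    (`|(G n t)%:E| <= (Ca * Cb * bump t)%:E)%E}.
  apply: aeW => t n _; rewrite /= lee_fin normrM (ger0_norm (bump_ge0 t)).
  by apply: ler_wpM2r; [exact: bump_ge0|rewrite normrM ler_pM].
by have [] := dominated_convergence measurableT mG mb cv ib le.
Unshelve. all: by end_near. Qed.

End approximate_identity.

Section green_representation.
Context {R : realType}.
Notation mu := (@lebesgue_measure R).
Implicit Types (a b : {poly R}) (z w : plane R).

(** With [u] the first coordinate of w, this one function majorizes the logarithms of [dist2 + e]
    and of [conj2], and [hyp_green] itself, for all z and w in the disk. *)
Definition dominant (u : R) (z : plane R) : \bar R :=
  (logsing22 (z.1 - u)%R + (ln 5)%:E)%E.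

Lemma dominant_ge0 u z : (0 <= dominant u z)%E.
Proof. by rewrite adde_ge0 ?logsing22_ge0// lee_fin ln_ge0// ler1n. Qed.

Lemma measurable_dominant u : measurable_fun setT (dominant u).
Proof.
apply: emeasurable_funD => //; apply: (measurableT_comp measurable_logsing22).
by apply: measurable_funB => //; exact: measurable_fst.
Qed.

Lemma integral_dominant (p q p' q' : R) : exists2 C : R, 0 <= C &
  forall u, (\int[area]_(z in box p q p' q') dominant u z <= C%:E)%E.
Proof.
have mQ := measurable_box p q p' q'.
pose K : \bar R := ((4 * ln 5 + 8)%:E * mu `[p', q'] +
  (ln 5)%:E * area (box p q p' q'))%E.
have ln50 : 0 <= ln 5 :> R by rewrite ln_ge0// ler1n.
have Koo : K \is a fin_num.
  rewrite /K fin_numD; apply/andP; split; apply: fin_numM => //.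
    by rewrite lebesgue_measure_itv/=; case: ifP.
  by rewrite ge0_fin_numE//; exact: area_box_lty.
have K0 : (0 <= K)%E.
  rewrite /K; apply: adde_ge0; apply: mule_ge0 => //.
  by rewrite lee_fin; apply: addr_ge0 => //; exact: mulr_ge0.
exists (fine K); first exact: fine_ge0.
move=> u; rewrite fineK// /dominant ge0_integralD//; last 2 first.
- by move=> z _; exact: logsing22_ge0.
- apply: measurable_funTS; apply: (measurableT_comp measurable_logsing22).
  by apply: measurable_funB => //; exact: measurable_fst.
by rewrite integral_cst//; apply: leeD => //; exact: integral_box_logsing22.
Qed.

Lemma integrable_dominant p q p' q' u :
  area.-integrable (box p q p' q') (dominant u).
Proof.
apply/integrableP; split.
  by apply: measurable_funTS; exact: measurable_dominant.
under eq_integral do rewrite gee0_abs ?dominant_ge0//.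
have [C _ hC] := integral_dominant p q p' q'.
by rewrite (le_lt_trans (hC u))// ltry.
Qed.

Lemma mbounded_laplacian a b p q p' q' :
  mbounded (box p q p' q') (laplacian a b).
Proof.
have bX := mbounded_fst p q p' q'; have bY := mbounded_snd p q p' q'.
by apply: mboundedD; apply: mboundedM; exact: mbounded_horner.
Qed.

Lemma negligible_point w : area.-negligible [set w].
Proof.
exists ([set w.1] `*` [set w.2]); split => //.
- by apply: measurableX; exact: measurable_set1.
- rewrite area_setX; [|exact: measurable_set1|exact: measurable_set1].
  by rewrite lebesgue_measure_set1 mul0e.
- by move=> z ->.
Qed.

Lemma quad_dist2 w e z :
  quad 1 (- (2 * w.1)) (- (2 * w.2)) (w.1 ^+ 2 + w.2 ^+ 2 + e) z = dist2 z w + e.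
Proof. by rewrite /quad /dist2; ring. Qed.

Lemma quad_conj2 w z :
  quad (w.1 ^+ 2 + w.2 ^+ 2) (- (2 * w.1)) (- (2 * w.2)) 1 z = conj2 z w.
Proof. by rewrite /quad /conj2; ring. Qed.

(** The real part of 1 - conj z w is at least 1 - (|z|^2 + |w|^2) / 2, hence at least (1 - |w|^2) /
    2. The bound is uniform in z, as Green's identity requires of its quadratic. *)
Lemma conj2_ge w z : unit_disk z -> unit_disk w ->
  ((1 - (w.1 ^+ 2 + w.2 ^+ 2)) / 2) ^+ 2 <= conj2 z w.
Proof.
move=> /unit_diskE + /unit_diskE; rewrite /conj2.
move: (z.1 : R) (z.2 : R) (w.1 : R) (w.2 : R) => x y u v zD wD.
apply: (@le_trans _ _ ((1 - x * u - y * v) ^+ 2)); last first.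
  by rewrite lerDl sqr_ge0.
have h1 := sqr_ge0 (x - u); have h2 := sqr_ge0 (y - v).
apply: lerXn2r; rewrite ?nnegrE; nra.
Qed.

Section fixed_box.
Variables (a b : {poly R}) (p q p' q' : R).
Hypotheses (pq : p < q) (p'q' : p' < q').
Hypotheses (ap : flat_at a p) (aq : flat_at a q).
Hypotheses (bp : flat_at b p') (bq : flat_at b q').
Hypothesis (a0 : forall x, p <= x <= q -> 0 <= a.[x]).
Hypothesis (b0 : forall y, p' <= y <= q' -> 0 <= b.[y]).
Let Q := box p q p' q'.
Hypothesis Q_disk : Q `<=` unit_disk.
Variable w : plane R.
Hypothesis w_disk : unit_disk w.

Let lap : plane R -> R := laplacian a b.
Let mQ : measurable Q. Proof. exact: measurable_box. Qed.

Let e_ (n : nat) : R := n.+1%:R^-1 ^+ 2.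

Let e_gt0 n : 0 < e_ n.
Proof. by rewrite exprn_gt0// invr_gt0. Qed.

Let e_le1 n : 0 <= e_ n <= 1.
Proof. by rewrite ltW//= exprn_ile1// ?invr_ge0// invf_le1// ler1n. Qed.

Let mlap : measurable_fun setT lap.
Proof. by have [] := mbounded_laplacian a b p q p' q'. Qed.

Let mdist2 : measurable_fun setT (dist2^~ w).
Proof.
by apply: measurable_funD; apply: measurable_funX; apply: measurable_funB => //.
Qed.

Let mconj2 : measurable_fun setT (conj2^~ w).
Proof.
apply: measurable_funD; apply: measurable_funX; apply: measurable_funB => //;
  do ?[apply: measurable_funB => //]; exact: measurable_funM.
Qed.

Lemma integrable_laplacianM (f : plane R -> R) : measurable_fun setT f ->
  (forall z, Q z -> (`|f z|%:E <= dominant w.1 z)%E) ->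
  area.-integrable Q (EFin \o (fun z => lap z * f z)).
Proof.
move=> mf fdom; have [_ [C lapC]] := mbounded_laplacian a b p q p' q'.
apply: (le_integrable mQ (g := fun z => C%:E * dominant w.1 z)%E).
- by apply/measurable_EFinP; apply: measurable_funTS; exact: measurable_funM.
- move=> z Qz; rewrite /= normrM EFinM.
  have C0 : 0 <= C := le_trans (normr_ge0 _) (lapC z Qz).
  rewrite [leRHS]gee0_abs; last by apply: mule_ge0; rewrite ?lee_fin ?dominant_ge0.
  by apply: lee_pmul; rewrite ?lee_fin// ?lapC// fdom.
- by apply: integrableZl => //; exact: integrable_dominant.
Qed.

Lemma integral_laplacian_ln_dist2 :
  (\int[area]_(z in Q) (lap z * ln (dist2 z w))%:E =
   (cutoff a p q w.1 * cutoff b p' q' w.2 * bump_mass)%:E)%E.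
Proof.
have [_ [C lapC]] := mbounded_laplacian a b p q p' q'.
have mf_ n : measurable_fun Q (fun z => (lap z * ln (dist2 z w + e_ n))%:E).
  apply/measurable_EFinP; apply: measurable_funTS; apply: measurable_funM => //.
  by apply: (measurableT_comp (@measurable_ln R)); exact: measurable_funD.
have mf : measurable_fun Q (fun z => (lap z * ln (dist2 z w))%:E).
  apply/measurable_EFinP; apply: measurable_funTS; apply: measurable_funM => //.
  exact: (measurableT_comp (@measurable_ln R)).
have cv : {ae area, forall z, Q z ->
    (lap z * ln (dist2 z w + e_ n))%:E @[n --> \oo] --> (lap z * ln (dist2 z w))%:E}.
  (* Convergence can fail only at z = w, where ln 0 has the default value 0 while the logarithms
     tend to minus infinity. *)
  apply: negligibleS (negligible_point w) => z /= zw; apply: contrapT => nzw.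
  apply: zw => _; apply: cvg_EFin; first by near=> n.
  apply: cvgM; first exact: cvg_cst.
  have d0 : 0 < dist2 z w.
    by rewrite lt_neqAle dist2_ge0 eq_sym andbT; apply/eqP => /dist2_eq0.
  have ce : dist2 z w + e_ n @[n --> \oo] --> dist2 z w.
    rewrite -[X in _ --> X]addr0; apply: cvgD; first exact: cvg_cst.
    rewrite -[X in _ --> X](mulr0 0).
    rewrite (_ : e_ = fun n => n.+1%:R^-1 * n.+1%:R^-1).
      by apply: cvgM; exact: cvg_harmonic.
    by apply/funext => n; rewrite /e_ expr2.
  exact: (cvg_comp _ _ ce (continuous_ln d0)).
have ig : area.-integrable Q (fun z => C%:E * dominant w.1 z)%E.
  by apply: integrableZl => //; exact: integrable_dominant.
have le : {ae area, forall z n, Q z ->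
    (`|(lap z * ln (dist2 z w + e_ n))%:E| <= C%:E * dominant w.1 z)%E}.
  apply: aeW => z n Qz; rewrite /= normrM EFinM.
  apply: lee_pmul; rewrite ?lee_fin// ?lapC//.
  by apply: ln_dist2_le => //; exact: Q_disk.
have [_ _ h] := dominated_convergence mQ mf_ mf cv ig le.
have [apz _] := ap; have [aqz _] := aq; have [bpz _] := bp; have [bqz _] := bq.
have := cvg_integral_poisson (w := w) pq p'q' apz aqz bpz bqz a0 b0.
(* One sequence has two limits: by domination it tends to the left side; rewritten by Green's
   identity, with discriminant 4 e, it tends to the right side. *)
move=> k; apply: (cvg_unique _ h _) => //.
rewrite (_ : [sequence _]_n = fun n => (\int[area]_(z in Q) (a.[z.1] * b.[z.2] *
    (4 * n.+1%:R^-1 ^+ 2 / (dist2 z w + n.+1%:R^-1 ^+ 2) ^+ 2))%:E)%E)//.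
apply/funext => n /=.
have := @integral_laplacian_ln R a b p q p' q' 1 (- (2 * w.1)) (- (2 * w.2))
  (w.1 ^+ 2 + w.2 ^+ 2 + e_ n) (e_ n) pq p'q' ap aq bp bq (e_gt0 n).
have -> : 4 * 1 * (w.1 ^+ 2 + w.2 ^+ 2 + e_ n) - (- (2 * w.1)) ^+ 2
  - (- (2 * w.2)) ^+ 2 = 4 * e_ n :> R by ring.
have bnd z : box p q p' q' z -> e_ n <= quad 1 (- (2 * w.1)) (- (2 * w.2))
    (w.1 ^+ 2 + w.2 ^+ 2 + e_ n) z.
  by move=> _; rewrite quad_dist2 lerDr dist2_ge0.
move=> /(_ bnd) H; rewrite -[RHS](eq_integral _ _ (fun z _ => congr1 (fun r =>
  (a.[z.1] * b.[z.2] * (4 * e_ n / r ^+ 2))%:E) (quad_dist2 w (e_ n) z))) -H.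
by apply: eq_integral => z _; rewrite quad_dist2.
Unshelve. all: by end_near. Qed.

Lemma integral_laplacian_ln_conj2 :
  (\int[area]_(z in Q) (lap z * ln (conj2 z w))%:E = 0)%E.
Proof.
pose m : R := ((1 - (w.1 ^+ 2 + w.2 ^+ 2)) / 2) ^+ 2.
have m0 : 0 < m.
  by rewrite exprn_gt0// divr_gt0// subr_gt0; exact/unit_diskE.
have := @integral_laplacian_ln R a b p q p' q' (w.1 ^+ 2 + w.2 ^+ 2)
  (- (2 * w.1)) (- (2 * w.2)) 1 m pq p'q' ap aq bp bq m0.
have -> : 4 * (w.1 ^+ 2 + w.2 ^+ 2) * 1 - (- (2 * w.1)) ^+ 2
  - (- (2 * w.2)) ^+ 2 = 0 :> R by ring.
have bnd z : box p q p' q' z -> m <= quad (w.1 ^+ 2 + w.2 ^+ 2)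
    (- (2 * w.1)) (- (2 * w.2)) 1 z.
  by move=> Qz; rewrite quad_conj2; apply: conj2_ge => //; exact: Q_disk.
move=> /(_ bnd); under [X in _ = X -> _]eq_integral do rewrite mul0r mulr0.
rewrite integral0 => H; rewrite -[RHS]H.
by apply: eq_integral => z _; rewrite quad_conj2.
Qed.

Lemma integral_laplacian_hyp_green :
  (\int[area]_(z in Q) (lap z * hyp_green z w)%:E =
   (- (bump_mass / 2) * (cutoff a p q w.1 * cutoff b p' q' w.2))%:E)%E.
Proof.
have ic : area.-integrable Q (EFin \o (fun z => lap z * ln (conj2 z w))).
  apply: integrable_laplacianM.
    exact: (measurableT_comp (@measurable_ln R)).
  move=> z Qz; have zD := Q_disk Qz; apply: ln_le_logsing22 => //.
    rewrite conj2E lerDl mulr_ge0// subr_ge0; exact/ltW/unit_diskE.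
  exact: conj2_le5.
have id : area.-integrable Q (EFin \o (fun z => lap z * ln (dist2 z w))).
  apply: integrable_laplacianM.
    exact: (measurableT_comp (@measurable_ln R)).
  move=> z Qz; have zD := Q_disk Qz; apply: ln_le_logsing22 => //.
  by have := dist2_le4 zD w_disk; lra.
have mG : measurable_fun setT (hyp_green^~ w).
  exact: (measurableT_comp measurable_hyp_green (pair2_measurable w)).
transitivity (\int[area]_(z in Q) (2^-1%:E *
    ((lap z * ln (conj2 z w))%:E - (lap z * ln (dist2 z w))%:E)))%E.
  apply: ae_eq_integral => //.
  - by apply/measurable_EFinP; apply: measurable_funTS; exact: measurable_funM.
  - apply: measurable_funTS; apply: measurable_funeM.
    by apply: emeasurable_funB; apply/measurable_EFinP; apply: measurable_funM => //;
      exact: (measurableT_comp (@measurable_ln R)).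
  - apply: negligibleS (negligible_point w) => z /= zw; apply: contrapT => nzw.
    apply: zw => Qz; rewrite hyp_greenE//; last exact: Q_disk.
    by rewrite -EFinB -EFinM; congr EFin; ring.
rewrite integralZl//; last exact: integrableB.
rewrite integralB_EFin// integral_laplacian_ln_conj2 integral_laplacian_ln_dist2.
by rewrite sub0e -EFinN -EFinM; congr EFin; lra.
Qed.

End fixed_box.

End green_representation.

(** * Polynomial approximation of the indicator of an interval *)

Section plateau.
Context {R : realType}.
Variables (p q : R).

(** The square makes 1 - [dip] vanish to second order at p and q, and every plateau is a multiple of
    1 - [dip]. The factor (q - p)^-4 normalizes the inequality (x - p) (q - x) <= (q - p)^2 on
    [p, q]. *)
Definition dip : {poly R} :=
  1 - ((q - p) ^- 4)%:P * (('X - p%:P) * (q%:P - 'X)) ^+ 2.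

(* [dip] takes values in [0, 1] on [p, q] and is 1 only at the two ends, so the
   plateaus converge to the indicator of ]p, q[. *)
Definition plateau (n : nat) : {poly R} := 1 - dip ^+ n.

Lemma dipE x : dip.[x] = 1 - (q - p) ^- 4 * ((x - p) * (q - x)) ^+ 2.
Proof. by rewrite /dip !hornerE. Qed.

Lemma plateauE n x : (plateau n).[x] = 1 - dip.[x] ^+ n.
Proof. by rewrite /plateau hornerD hornerN hornerC horner_exp. Qed.

Lemma deriv_dip x : (x - p) * (q - x) = 0 -> dip^`().[x] = 0.
Proof.
move=> x0; rewrite /dip !poly.derivE !hornerE/= x0.
by rewrite -mulrA x0 !(mul0r, mulr0, subr0, add0r, addr0, oppr0, mul0rn).
Qed.

Lemma flat_at_plateau n x : (x - p) * (q - x) = 0 -> flat_at (plateau n) x.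
Proof.
move=> x0; split.
  by rewrite plateauE dipE x0 expr0n/= mulr0 subr0 expr1n subrr.
rewrite /plateau derivB derivC sub0r deriv_exp hornerN hornerMn hornerM.
by rewrite deriv_dip// mul0r mul0rn oppr0.
Qed.

Hypothesis pq : p < q.

Lemma dip_ge0 x : p <= x <= q -> 0 <= dip.[x].
Proof.
move=> /andP[px xq]; rewrite dipE subr_ge0 mulrC ler_pdivrMr ?exprn_gt0 ?subr_gt0//.
rewrite mul1r (_ : (q - p) ^+ 4 = ((q - p) ^+ 2) ^+ 2); last by rewrite -exprM.
by apply: lerXn2r; rewrite ?nnegrE ?sqr_ge0//; nra.
Qed.

Lemma dip_le1 x : dip.[x] <= 1.
Proof.
rewrite dipE gerBl mulr_ge0 ?sqr_ge0// invr_ge0 exprn_even_ge0//.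
Qed.

Lemma dip_lt1 x : p < x < q -> dip.[x] < 1.
Proof.
move=> /andP[px xq]; rewrite dipE gtrBl mulr_gt0//.
  by rewrite invr_gt0 exprn_gt0// subr_gt0.
by rewrite exprn_gt0// mulr_gt0// subr_gt0.
Qed.

Lemma plateau_ge0 n x : p <= x <= q -> 0 <= (plateau n).[x].
Proof. by move=> xpq; rewrite plateauE subr_ge0 exprn_ile1// ?dip_ge0// dip_le1. Qed.

Lemma plateau_le1 n x : p <= x <= q -> (plateau n).[x] <= 1.
Proof. by move=> xpq; rewrite plateauE gerBl exprn_ge0// dip_ge0. Qed.

Lemma cutoff_plateau_le1 n x : `|cutoff (plateau n) p q x| <= 1.
Proof.
rewrite /cutoff patchE; case: ifPn => [/set_mem/=|_]; last by rewrite normr0.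
by rewrite in_itv/= => xpq; rewrite ger0_norm ?plateau_ge0// plateau_le1.
Qed.

Lemma cvg_cutoff_plateau x :
  cutoff (plateau n) p q x @[n --> \oo] --> (\1_(`]p, q[%classic) x : R).
Proof.
rewrite indicE; case: (boolP (x \in `]p, q[%classic)) => [/set_mem/=|].
  rewrite in_itv/= => xpq; have /andP[px xq] := xpq.
  have xpq' : p <= x <= q by rewrite !ltW.
  rewrite (_ : (fun n => _) = fun n => 1 - dip.[x] ^+ n).
    rewrite -[X in _ --> X]subr0; apply: cvgB; first exact: cvg_cst.
    by apply: cvg_expr; rewrite ger0_norm ?dip_ge0// dip_lt1.
  have xI : `[p, q]%classic x by rewrite /= in_itv.
  by apply/funext => n; rewrite /cutoff patchE (mem_set xI) plateauE.
rewrite notin_setE/= in_itv/= => xpq.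
rewrite (_ : (fun n => _) = cst 0); first exact: cvg_cst.
apply/funext => n; rewrite /cutoff patchE; case: ifPn => // /set_mem/=.
rewrite in_itv/= => /andP[px xq].
suff x0 : (x - p) * (q - x) = 0 by have [] := flat_at_plateau n x0.
apply/eqP; rewrite mulf_eq0 !subr_eq0.
move: px xq; rewrite !le_eqVlt => /orP[/eqP ->|px]; first by rewrite eqxx.
move=> /orP[/eqP ->|xq]; first by rewrite eqxx orbT.
by exfalso; apply: xpq; rewrite px.
Qed.

Lemma measurable_cutoff (a : {poly R}) (c d : R) :
  measurable_fun [set: measurableTypeR R] (cutoff a c d).
Proof.
apply/(measurable_restrictT _ _).1 => //; apply: measurable_funTS.
by apply: continuous_measurable_fun; exact: continuous_horner.
Qed.

End plateau.

(** * Functions with vanishing integrals over boxes *)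

Section density_measure.
Local Open Scope ereal_scope.
Context d (T : measurableType d) {R : realType}.
Variables (m : {measure set T -> \bar R}) (f : T -> \bar R).

(** Measurability and sign are arguments of the definition, so that the term itself can carry a
    measure structure. *)
Definition density of measurable_fun setT f & (forall x, 0 <= f x) :=
  fun A : set T => \int[m]_(x in A) f x.

Hypotheses (mf : measurable_fun setT f) (f0 : forall x, 0 <= f x).

Let density0 : density mf f0 set0 = 0.
Proof. by rewrite /density integral_set0. Qed.

Let density_ge0 A : 0 <= density mf f0 A.
Proof. by apply: integral_ge0. Qed.

Let density_sigma_additive : semi_sigma_additive (density mf f0).
Proof.
move=> /= A mA tA mUA; rewrite /density ge0_integral_bigcup//=.
  by apply: is_cvg_ereal_nneg_natsum_cond => n _ _; exact: density_ge0.
exact: measurable_funTS.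
Qed.

HB.instance Definition _ := isMeasure.Build _ _ _ (density mf f0)
  density0 density_ge0 density_sigma_additive.

End density_measure.

Section zero_on_boxes.
Context {R : realType}.

Definition obox (p q p' q' : R) : set (plane R) :=
  `]p, q[%classic `*` `]p', q'[%classic.

Lemma measurable_obox p q p' q' : measurable (obox p q p' q').
Proof. by apply: measurableX. Qed.

(** A quadrant cuts an open box in an open box with the same upper right corner, or in the empty
    set; so a pi-system of quadrants asks only for integrals over such boxes. *)
Definition quadrant (s t : R) : set (plane R) :=
  `]s, +oo[%classic `*` `]t, +oo[%classic.

Lemma measurable_quadrant s t : measurable (quadrant s t).
Proof. by apply: measurableX. Qed.

Definition quadrants : set (set (plane R)) :=
  [set A | exists s t : R, A = quadrant s t].

Lemma quadrants_setI : setI_closed quadrants.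
Proof.
move=> _ _ [s [t ->]] [s' [t' ->]]; exists (Num.max s s'), (Num.max t t').
rewrite /quadrant -setXI; congr (_ `*` _); apply/seteqP; split => x /=;
  rewrite !in_itv/= !andbT gt_max.
- by move=> [-> ->].
- by move/andP.
- by move=> [-> ->].
- by move/andP.
Qed.

Lemma bigcup_rays : \bigcup_n `](- n%:R : R)%R, +oo[%classic = setT.
Proof.
rewrite -subTset => x _; have [n /ltW nx] : exists n : nat, - x < n%:R.
  exists (Num.trunc `|x|).+1; apply: le_lt_trans (ler_norm _) _.
  by rewrite normrN; exact: truncnS_gt.
by exists n.+1 => //=; rewrite in_itv/= andbT ltrNl (le_lt_trans nx)// ltr_nat.
Qed.

(** The preimages of open rays under the two projections generate the product sigma-algebra, and
    each of these half-planes is a countable union of quadrants. *)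
Lemma measurable_quadrants :
  (measurable : set (set (plane R))) = <<s quadrants >>.
Proof.
apply/seteqP; split; last first.
  apply: smallest_sub; first exact: sigma_algebra_measurable.
  by move=> _ [s [t ->]]; exact: measurable_quadrant.
apply: smallest_sub; first exact: smallest_sigma_algebra.
have mE : (@measurable _ (measurableTypeR R)) = <<s @RGenOInfty.G R >>.
  exact: RGenOInfty.measurableE.
have sbU : forall F : (set (plane R))^nat,
    (forall n, <<s quadrants >> (F n)) -> <<s quadrants >> (\bigcup_n F n).
  by have [_ _] := smallest_sigma_algebra (setT : set (plane R)) quadrants.
rewrite subUset mE; split.
  rewrite -[X in X `<=` _](g_sigma_preimageE setT fst (@RGenOInfty.G R)).
  apply: smallest_sub; first exact: smallest_sigma_algebra.
  move=> _ [_ [s ->] <-]; rewrite setTI.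
  rewrite (_ : _ @^-1` _ = \bigcup_n quadrant s (- n%:R)).
    by apply: sbU => n; apply: sub_sigma_algebra; exists s, (- n%:R).
  rewrite -setX_bigcupr bigcup_rays; apply/seteqP; split => z //=.
  by move=> [].
rewrite -[X in X `<=` _](g_sigma_preimageE setT snd (@RGenOInfty.G R)).
apply: smallest_sub; first exact: smallest_sigma_algebra.
move=> _ [_ [s ->] <-]; rewrite setTI.
rewrite (_ : _ @^-1` _ = \bigcup_n quadrant (- n%:R) s).
  by apply: sbU => n; apply: sub_sigma_algebra; exists (- n%:R), s.
rewrite -setX_bigcupl bigcup_rays; apply/seteqP; split => z //=.
by move=> [].
Qed.

(** The positive and negative parts of [v] on the box are densities of two finite measures. These
    agree on quadrants, hence on all Borel sets, so [v] has integral 0 over every measurable part of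
    the box. *)
Lemma ae_eq0_obox (m : {measure set (plane R) -> \bar R}) (v : plane R -> R)
    (p q p' q' : R) :
  m.-integrable setT (EFin \o v) ->
  (forall s t, p <= s < q -> p' <= t < q' ->
    (\int[m]_(z in obox s q t q') (v z)%:E = 0)%E) ->
  ae_eq m (obox p q p' q') v (cst 0).
Proof.
move=> iv v0; set B := obox p q p' q'.
have mB : measurable B by exact: measurable_obox.
pose g := (EFin \o v) \_ B.
have ig : m.-integrable setT g.
  by apply/(integrable_mkcond _ mB).1; exact: integrableS iv.
have mg := measurable_int m ig.
have mp : measurable_fun setT (g^\+)%E by exact: measurable_funepos.
have mn : measurable_fun setT (g^\-)%E by exact: measurable_funeneg.
have p0 z : (0 <= (g^\+)%E z)%E by rewrite funeposE le_max lexx orbT.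
have n0 z : (0 <= (g^\-)%E z)%E by rewrite funenegE le_max lexx orbT.
pose m1 := density m mp p0.
pose m2 := density m mn n0.
have fin1 A : measurable A -> (m1 A < +oo)%E.
  move=> mA; rewrite /m1 /density; apply: integrable_lty => //.
  by apply: integrable_funepos => //; exact: integrableS ig.
have fin2 A : measurable A -> (m2 A < +oo)%E.
  move=> mA; rewrite /m2 /density; apply: integrable_lty => //.
  by apply: integrable_funeneg => //; exact: integrableS ig.
have E A : measurable A -> (\int[m]_(z in A) g z = m1 A - m2 A)%E.
  by move=> mA; rewrite integralE.
have gq s t : (\int[m]_(z in quadrant s t) g z = 0)%E.
  rewrite -integral_mkcondr /quadrant /B /obox -setXI.
  rewrite (_ : _ `*` _ = obox (Num.max s p) q (Num.max t p') q'); last first.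
    rewrite /obox; apply/seteqP; split => z [] /=; rewrite /setX/=.
      rewrite !in_itv/= !andbT !gt_max.
      by move=> [-> /andP[-> ->]] [-> /andP[-> ->]].
    rewrite !in_itv/= !andbT !gt_max.
    by move=> /andP[/andP[-> ->] ->] /andP[/andP[-> ->] ->].
  have [sq|qs] := ltP (Num.max s p) q; last first.
    rewrite (_ : obox _ _ _ _ = set0) ?integral_set0//.
    apply/seteqP; split => z //= [] /=; rewrite !in_itv/= => /andP[h1 h2].
    by have := lt_trans h1 h2; rewrite ltNge qs.
  have [tq|qt] := ltP (Num.max t p') q'; last first.
    rewrite (_ : obox _ _ _ _ = set0) ?integral_set0//.
    apply/seteqP; split => z //= [] /= _; rewrite !in_itv/= => /andP[h1 h2].
    by have := lt_trans h1 h2; rewrite ltNge qt.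
  by apply: v0; rewrite ?sq ?tq le_max lexx orbT.
have m12 A : measurable A -> m1 A = m2 A.
  move=> mA; apply: (measure_unique quadrants
    (fun n => quadrant (- n%:R) (- n%:R))) => //.
  - exact: measurable_quadrants.
  - exact: quadrants_setI.
  - by move=> n; exists (- n%:R), (- n%:R).
  - rewrite -subTset => z _.
    have [n _ zn] : (\bigcup_n `](- n%:R : R)%R, +oo[%classic) z.1.
      by rewrite bigcup_rays.
    have [k _ zk] : (\bigcup_n `](- n%:R : R)%R, +oo[%classic) z.2.
      by rewrite bigcup_rays.
    exists (maxn n k) => //; split; move: zn zk; rewrite /= !in_itv/= !andbT => zn zk.
      by apply: le_lt_trans zn; rewrite lerN2 ler_nat leq_maxl.
    by apply: le_lt_trans zk; rewrite lerN2 ler_nat leq_maxr.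
  - move=> _ [s [t ->]]; have mst := measurable_quadrant s t.
    have f1 : m1 (quadrant s t) \is a fin_num.
      by rewrite ge0_fin_numE ?fin1//; exact: measure_ge0.
    have /esym/eqP := E _ mst; rewrite gq sube_eq ?add0e; first by move/eqP.
      exact: f1.
    by rewrite fin_num_adde_defr.
  - by move=> n; apply: fin1; exact: measurable_quadrant.
have : ae_eq m B (EFin \o v) (cst 0%E).
  apply: integral_ae_eq => //.
    exact: integrableS iv.
  move=> A AB mA; rewrite integral0.
  transitivity (\int[m]_(z in A) g z)%E.
    by rewrite -integral_mkcondr setIidl.
  by rewrite E// m12// subee// ge0_fin_numE ?measure_ge0// fin2.
by apply: filterS => z /= h Bz; have [] := h Bz.
Qed.

End zero_on_boxes.

(** * Open sets and bounded sets in the hyperbolic plane *)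

Section box_cover.
Context {R : realType}.

(** Rational corners keep the family of boxes countable, so that the null sets found in the single
    boxes have a null union. *)
Lemma open_box_nbhs (Omega : set (plane R)) z : open Omega -> Omega z ->
  exists p q p' q' : rat, [/\ ratr p < ratr q :> R, ratr p' < ratr q' :> R,
    box (ratr p) (ratr q) (ratr p') (ratr q') `<=` Omega &
    obox (ratr p : R) (ratr q) (ratr p') (ratr q') z].
Proof.
rewrite openE => /(_ z)/[apply]; case=> -[A B] /= [nA nB] ABO.
have [e e0 eA] : nbhs_ball (z.1 : R) A by exact/nbhs_ballP.
have [f f0 fB] : nbhs_ball (z.2 : R) B by exact/nbhs_ballP.
have itv (x d : R) : 0 < d -> exists a b : rat,
    [/\ x - d < ratr a, ratr a < x, x < ratr b & ratr b < x + d].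
  move=> d0.
  have [|a] := @rat_in_itvoo R (x - d) x; first by rewrite gtrBl.
  have [|b] := @rat_in_itvoo R x (x + d); first by rewrite ltrDl.
  by rewrite !in_itv/= => /andP[? ?] /andP[? ?]; exists a, b.
have [p [q [p1 p2 q1 q2]]] := itv z.1 _ e0.
have [p' [q' [p1' p2' q1' q2']]] := itv z.2 _ f0.
exists p, q, p', q'; split.
- exact: lt_trans p2 q1.
- exact: lt_trans p2' q1'.
- move=> y [/=]; rewrite !in_itv/= => /andP[y1 y2] /andP[y1' y2'].
  apply: ABO; split => /=.
    by apply: eA; rewrite /ball/= ltr_norml; apply/andP; split; lra.
  by apply: fB; rewrite /ball/= ltr_norml; apply/andP; split; lra.
- by split; rewrite /= in_itv/= ?p2 ?q1 ?p2' ?q1'.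
Qed.

Lemma open_bigcup_obox (Omega : set (plane R)) : open Omega ->
  exists F : (set (plane R))^nat, Omega = \bigcup_n F n /\
    forall n, F n = set0 \/ exists p q p' q' : R,
      [/\ p < q, p' < q', box p q p' q' `<=` Omega & F n = obox p q p' q'].
Proof.
move=> oO.
pose P (x : rat * rat * (rat * rat)) : Prop :=
  [/\ ratr x.1.1 < ratr x.1.2 :> R, ratr x.2.1 < ratr x.2.2 :> R &
      box (ratr x.1.1) (ratr x.1.2) (ratr x.2.1) (ratr x.2.2) `<=` Omega].
pose B (x : rat * rat * (rat * rat)) : set (plane R) :=
  obox (ratr x.1.1) (ratr x.1.2) (ratr x.2.1) (ratr x.2.2).
pose F n : set (plane R) := if unpickle n is Some x then
  if `[< P x >] then B x else set0 else set0.
exists F; split.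
  apply/seteqP; split => z.
    move=> /(open_box_nbhs oO) [p [q [p' [q' [h1 h2 h3 h4]]]]].
    exists (pickle ((p, q), (p', q'))); first exact: I.
    rewrite /F pickleK.
    by case: asboolP => // -[]; split.
  move=> [n _]; rewrite /F; case: unpickle => // x; case: asboolP => // -[_ _ h].
  case=> /=; rewrite !in_itv/= => /andP[h1 h2] /andP[h3 h4].
  by apply: h; split; rewrite /= in_itv/= !ltW.
move=> n; rewrite /F; case: unpickle => [x|]; last by left.
case: asboolP => [[h1 h2 h3]|_]; last by left.
by right; exists (ratr x.1.1), (ratr x.1.2), (ratr x.2.1), (ratr x.2.2).
Qed.

Lemma measurable_open_plane (Omega : set (plane R)) : open Omega -> measurable Omega.
Proof.
move=> /open_bigcup_obox[F [-> hF]]; apply: bigcup_measurable => n _.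
case: (hF n) => [->//|[p [q [p' [q' [_ _ _ ->]]]]]]; exact: measurable_obox.
Qed.

End box_cover.

(** * Hyperbolically bounded sets and null sets *)

Section hyp_measure_facts.
Context {R : realType}.
Notation mu := (@lebesgue_measure R).
Implicit Types (Omega : set (plane R)).

Definition nsq (z : plane R) : R := z.1 ^+ 2 + z.2 ^+ 2.

(* With [t] the pseudo-hyperbolic distance, a bound on the distance to a fixed
   [z0] bounds [1 - t^2 = (1 - |z0|^2)(1 - |w|^2) / conj2 z0 w] from below. *)
Lemma hyp_bounded_nsq Omega : Omega `<=` unit_disk -> hyp_bounded Omega ->
  exists2 r : R, r < 1 & forall z, Omega z -> nsq z <= r.
Proof.
move=> OD [M OM]; have [->|/set0P[z0 Oz0]] := eqVneq Omega set0.
  by exists 0.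
have /unit_diskE z01 := OD _ Oz0.
pose E := expR M.
have E0 : 0 < E by exact: expR_gt0.
(* This is tanh (M / 2), the solution of (1 + rho) / (1 - rho) = E: a hyperbolic distance at most M
   means a pseudo-hyperbolic distance at most rho. *)
pose rho := (E - 1) / (E + 1).
have rho1 : 0 < 1 - rho ^+ 2.
  have -> : 1 - rho ^+ 2 = 4 * E / (E + 1) ^+ 2.
    by rewrite /rho; field; rewrite gt_eqF// addr_gt0.
  by apply: divr_gt0; [exact: mulr_gt0|apply: exprn_gt0; exact: addr_gt0].
(* A lower bound for (1 - |z0|^2) (1 - |w|^2) = (1 - t^2) [conj2 z0 w], from t <= rho and
   [conj2_ge]. *)
pose k := (1 - rho ^+ 2) * ((1 - nsq z0) / 2) ^+ 2.
have k0 : 0 < k.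
  by apply: mulr_gt0 => //; apply: exprn_gt0; apply: divr_gt0 => //; rewrite subr_gt0.
exists (1 - k); first by rewrite gtrBl.
move=> w Ow; have wD := OD _ Ow; have z0D := OD _ Oz0.
have /unit_diskE w1 := wD.
have c0 := conj2_gt0 z0D wD.
pose t := pseudo_hyp_dist z0 w.
have tE : t ^+ 2 = dist2 z0 w / conj2 z0 w.
  by rewrite /t pseudo_hyp_distE expr_div_n !sqr_sqrtr ?dist2_ge0// ltW.
have t0 : 0 <= t by rewrite /t pseudo_hyp_distE divr_ge0// sqrtr_ge0.
have tlt : 1 - t ^+ 2 = (1 - nsq z0) * (1 - nsq w) / conj2 z0 w.
  rewrite tE /nsq; have := conj2E z0 w => ->; field.
  by rewrite -conj2E gt_eqF.
have t1 : t < 1.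
  rewrite -(@expr_lt1 _ 2)// -subr_gt0 tlt divr_gt0// mulr_gt0// subr_gt0//.
have := OM _ _ Oz0 Ow; rewrite /hyp_dist /artanh -/t mulrA divff// mul1r => hM.
have t1' : 0 < 1 - t by rewrite subr_gt0.
have : (1 + t) / (1 - t) <= E.
  have pt : 0 < (1 + t) / (1 - t) by apply: divr_gt0 => //; lra.
  by rewrite -(ler_ln pt E0) /E expRK.
rewrite ler_pdivrMr// => tM.
have trho : t <= rho by rewrite /rho ler_pdivlMr ?addr_gt0//; nra.
have : 1 - rho ^+ 2 <= (1 - nsq z0) * (1 - nsq w) / conj2 z0 w.
  by rewrite -tlt lerD2l lerN2; apply: lerXn2r; rewrite ?nnegrE// (le_trans t0).
rewrite ler_pdivlMr// => h.
have hc : ((1 - nsq z0) / 2) ^+ 2 <= conj2 z0 w.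
  have -> : conj2 z0 w = conj2 w z0 by rewrite /conj2; ring.
  exact: conj2_ge.
have h2 : k <= (1 - nsq z0) * (1 - nsq w).
  by apply: le_trans h; rewrite /k ler_wpM2l// ltW.
have n0 : 0 <= nsq z0 by rewrite addr_ge0// sqr_ge0.
have : (1 - nsq z0) * (1 - nsq w) <= 1 - nsq w.
  by rewrite ler_piMl ?subr_ge0 ?gerBl// ltW.
lra.
Qed.

Lemma hyp_density_gt0 (z : plane R) : unit_disk z -> 0 < hyp_density z.
Proof.
move=> /unit_diskE z1; rewrite /hyp_density.
apply: mulr_gt0; rewrite invr_gt0 ?pi_gt0// exprn_gt0// subr_gt0.
by rewrite normc_cplxE.
Qed.

Lemma hyp_measure_lty Omega (r : R) : measurable Omega -> Omega `<=` unit_disk ->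
  r < 1 -> (forall z, Omega z -> nsq z <= r) -> (hyp_measure Omega < +oo)%E.
Proof.
move=> mO OD r1 Or; rewrite /hyp_measure setIidl//.
pose C := pi^-1 * ((1 - r) ^+ 2)^-1 : R.
have OB : Omega `<=` box (-1) 1 (-1) 1.
  move=> z /OD/unit_diskE; rewrite /box /setX/= !in_itv/=.
  move: (z.1 : R) (z.2 : R) => x y h; split; apply/andP; split; nra.
apply: (@le_lt_trans _ _ (\int[area]_(z in Omega) C%:E)%E).
  apply: ge0_le_integral => //.
  - by move=> z _; rewrite lee_fin hyp_density_ge0.
  - by apply/measurable_EFinP; apply: measurable_funTS; exact: measurable_hyp_density.
  - move=> z Oz; rewrite lee_fin /hyp_density /C ler_wpM2l ?invr_ge0 ?pi_ge0//.
    have h := Or _ Oz; rewrite lef_pV2 ?posrE ?exprn_gt0 ?subr_gt0//; last first.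
      by rewrite normc_cplxE (le_lt_trans h).
    rewrite normc_cplxE; move: h; rewrite /nsq; set n2 := _ + _ => h.
    by apply: lerXn2r; rewrite ?nnegrE; lra.
rewrite integral_cst//; apply: lte_mul_pinfty => //.
  by rewrite lee_fin /C mulr_ge0// invr_ge0 ?pi_ge0// sqr_ge0.
apply: le_lt_trans (area_box_lty (-1 : R) 1 (-1) 1).
by apply: le_measure; rewrite ?inE//; exact: measurable_box.
Qed.

(** The density is positive on the disk, so it can integrate to 0 only over an area-null set. This
    carries the vanishing of the potential over to area, the measure used in z. *)
Lemma hyp_negligible_area (N : set (plane R)) : N `<=` unit_disk ->
  hyp_measure.-negligible N -> area.-negligible N.
Proof.
move=> ND [A [mA A0 NA]]; have mD := @measurable_unit_disk R.
exists (A `&` unit_disk); split; [exact: measurableI| |]; last first.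
  by move=> z Nz; split; [exact: NA|exact: ND].
have mAD : measurable (A `&` unit_disk) by exact: measurableI.
have mh : measurable_fun (A `&` unit_disk) (fun z : plane R => (hyp_density z)%:E).
  by apply/measurable_EFinP; apply: measurable_funTS; exact: measurable_hyp_density.
have /(ae_eq_integral_abs _ mAD mh) [B [mB B0 hB]] :
    (\int[area]_(z in A `&` unit_disk) `|(hyp_density z)%:E| = 0)%E.
  rewrite -[RHS]A0 /hyp_measure; apply: eq_integral => z _.
  by rewrite gee0_abs// lee_fin hyp_density_ge0.
apply/eqP; rewrite eq_le measure_ge0 andbT -B0; apply: le_measure; rewrite ?inE//.
move=> z [Az Dz]; apply: hB => /= /(_ (conj Az Dz)) [] h.
by have := hyp_density_gt0 Dz; rewrite h ltxx.
Qed.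

End hyp_measure_facts.

(** * Functions whose potential vanishes *)

Section sigma_finite_area.
Context {R : realType}.

Lemma area_sigma_finite : sigma_finite setT (@area R).
Proof.
exists (fun n => box (- n%:R) n%:R (- n%:R) n%:R : set (plane R)); last first.
  by move=> n; split; [exact: measurable_box|exact: area_box_lty].
apply/esym; rewrite -subTset => z _; exists (Num.trunc (`|z.1| + `|z.2|)).+1 => //.
have := truncnS_gt (`|z.1| + `|z.2| : R); move: (_%:R) => c.
have := ler_norm (z.1 : R); have := ler_norm (z.2 : R).
have := ler_norm (- z.1 : R); have := ler_norm (- z.2 : R).
have := normr_ge0 (z.1 : R); have := normr_ge0 (z.2 : R).
rewrite !normrN => *; split; rewrite /= in_itv/=; apply/andP; split; lra.
Qed.

(* Canonical inference does not find the sigma-finiteness of a product measure: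
   the instance for subprobabilities takes precedence. *)
Definition sfarea : {sigma_finite_measure set (plane R) -> \bar R} :=
  HB.pack (Measure.sort (@area R)) (Measure.class (@area R))
    (Measure_isSigmaFinite.Build _ _ _ (@area R) area_sigma_finite).


End sigma_finite_area.

Section vanishing_potential.
Context {R : realType}.
Variables (Omega : set (plane R)) (u : plane R -> R).
Hypothesis Omega_disk : Omega `<=` unit_disk.
Hypothesis mOmega : measurable Omega.
Hypothesis Omega_lty : (hyp_measure Omega < +oo)%E.
Hypothesis u_L2 : L2_on Omega u.

(** Extending [u] by 0 and restricting the hyperbolic measure to [Omega], as the finite measure
    [nu], lets integrals in w run over the whole plane in Fubini's theorem. *)
Let v : plane R -> R := u \_ Omega.
Variable nu : {finite_measure set (plane R) -> \bar R}.
Hypothesis nu_restr : forall A, measurable A -> nu A = hyp_measure (A `&` Omega).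

Let v_out w : ~ Omega w -> v w = 0.
Proof. by move=> nOw; rewrite /v patchE memNset. Qed.

Let mv : measurable_fun setT v.
Proof. by have /sub_Lfun_mfun := u_L2; rewrite inE. Qed.

Let nuE (g : plane R -> \bar R) : (forall w, ~ Omega w -> g w = 0%E) ->
  (\int[nu]_w g w = \int[hyp_measure]_(w in Omega) g w)%E.
Proof.
move=> g0; have -> : g = g \_ Omega.
  apply/funext => w; rewrite patchE; case: ifPn => // /negP wO.
  by apply: g0 => Ow; apply: wO; rewrite inE.
rewrite -integral_mkcond.
transitivity (\int[hyp_measure]_(w in Omega) g w)%E.
  apply: eq_measure_integral => A mA AO.
  by apply: etrans (nu_restr mA) _; rewrite setIidl.
by apply: eq_integral => w wO; rewrite patchE wO.
Qed.

(** On a set of finite measure, |v| <= 1 + v^2 turns square integrability into integrability. *)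
Let iv : nu.-integrable setT (EFin \o v).
Proof.
have mvE : measurable_fun setT (EFin \o v) by exact/measurable_EFinP.
have isq : hyp_measure.-integrable Omega (EFin \o (fun w => v w ^+ 2)).
  by apply: integrableS (Lfun2_integrable_sqr u_L2).
have i1 : hyp_measure.-integrable Omega (EFin \o (cst 1 : plane R -> R)).
  apply: integrable_mbounded => //; exact: mbounded_cst.
apply/integrableP; split => //.
rewrite nuE; last by move=> w /v_out /= ->; rewrite normr0.
have /integrableP[_] := integrableD mOmega i1 isq; apply: le_lt_trans.
apply: ge0_le_integral => //.
- by apply: measurableT_comp => //; exact: measurable_funTS.
- apply: measurableT_comp => //; apply: emeasurable_funD.
    exact: (measurable_int _ i1).
  exact: (measurable_int _ isq).
- move=> w _ /=; rewrite lee_fin [leRHS]ger0_norm ?addr_ge0 ?sqr_ge0//.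
  rewrite -[v w ^+ 2]real_normK ?num_real//.
  by have := sqr_ge0 (`|v w| - 1); have := normr_ge0 (v w); nra.
Qed.

Hypothesis Lu0 : ae_eq hyp_measure Omega (hyp_log_potential Omega u)
  (fun w => 0 * u w).

Section fixed_box.
Variables (a b : {poly R}) (p q p' q' : R).
Hypotheses (pq : p < q) (p'q' : p' < q').
Hypotheses (ap : flat_at a p) (aq : flat_at a q).
Hypotheses (bp : flat_at b p') (bq : flat_at b q').
Hypothesis (a0 : forall x, p <= x <= q -> 0 <= a.[x]).
Hypothesis (b0 : forall y, p' <= y <= q' -> 0 <= b.[y]).
Let Q := box p q p' q'.
Hypothesis QO : Q `<=` Omega.

Let mQ : measurable Q. Proof. exact: measurable_box. Qed.
Let QD : Q `<=` unit_disk. Proof. exact: subset_trans QO Omega_disk. Qed.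
Let lap : plane R -> R := laplacian a b.

Let f (zw : plane R * plane R) : R :=
  (lap \_ Q) zw.1 * hyp_green zw.1 zw.2 * v zw.2.

Let mlapQ : measurable_fun setT (lap \_ Q).
Proof.
apply/(measurable_restrictT _ _).1 => //; apply: measurable_funTS.
by have [] := mbounded_laplacian a b p q p' q'.
Qed.

Let mf : measurable_fun setT (EFin \o f).
Proof.
apply/measurable_EFinP; apply: measurable_funM.
  apply: measurable_funM; last exact: measurable_hyp_green.
  exact: (measurableT_comp mlapQ (@measurable_fst _ _ _ _)).
exact: (measurableT_comp mv (@measurable_snd _ _ _ _)).
Qed.

(** The integral of [dominant] is bounded uniformly in w, so the inner integral is at most a
    constant times |v(w)|, and joint integrability follows from that of [v]. *)
Let integral_normf : exists C : R, forall w,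
  (\int[area]_z `|(f (z, w))%:E| <= (C * `|v w|)%:E)%E.
Proof.
have [_ [CL lapC]] := mbounded_laplacian a b p q p' q'.
have CL0 : 0 <= CL.
  by apply: le_trans (normr_ge0 _) (lapC (p, p') _); split; rewrite /= in_itv/= lexx ltW.
have [C C0 hC] := integral_dominant p q p' q'.
exists (CL * C) => w; have [Ow|nOw] := pselect (Omega w); last first.
  rewrite (_ : (\int[area]_z _)%E = 0%E) ?lee_fin ?mulr_ge0//.
  by apply: integral0_eq => z _; rewrite /f /= (v_out nOw) mulr0 normr0.
have wD := Omega_disk Ow.
apply: (@le_trans _ _ (\int[area]_(z in Q) ((CL * `|v w|)%:E * dominant w.1 z))%E).
  rewrite [leRHS]integral_mkcond; apply: ge0_le_integral => //.
  - apply: measurableT_comp => //.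
    exact: (measurableT_comp mf (pair2_measurable w)).
  - apply/(measurable_restrictT _ _).1 => //; apply: measurable_funTS.
    by apply: measurable_funeM; exact: measurable_dominant.
  - move=> z _; rewrite /f /= !patchE; case: ifPn => [zQ|_]; last first.
      by rewrite !mul0r normr0.
    rewrite !normrM mulrAC EFinM; apply: lee_pmul; rewrite ?lee_fin//.
      by rewrite ler_wpM2r//; apply: lapC; exact: set_mem.
    by apply: hyp_green_le => //; apply: QD; exact: set_mem.
rewrite ge0_integralZl//; last 3 first.
- by apply: measurable_funTS; exact: measurable_dominant.
- by move=> z _; exact: dominant_ge0.
- by rewrite lee_fin mulr_ge0.
rewrite mulrAC (EFinM (CL * _)); apply: lee_wpmul2l; first by rewrite lee_fin mulr_ge0.
exact: hC.
Qed.

Let if_ : (sfarea \x nu)%E.-integrable setT (EFin \o f).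
Proof.
apply: (@integrable21ltyP _ _ _ _ R sfarea nu _ mf).2; have [C hC] := integral_normf.
apply: (@le_lt_trans _ _ (\int[nu]_w (`|C|%:E * `|(v w)%:E|))%E).
  apply: ge0_le_integral => //.
  - by move=> w _; apply: integral_ge0.
  - apply: (measurable_fun_fubini_tonelli_G (m1 := sfarea) (abse \o (EFin \o f))).
      exact: measurableT_comp.
    by move=> x; exact: abse_ge0.
  - apply: measurable_funeM; apply: measurableT_comp => //; exact/measurable_EFinP.
  - move=> w _; apply: le_trans (hC w) _.
    by rewrite -EFinM lee_fin ler_wpM2r// ler_norm.
rewrite ge0_integralZl//; last first.
  by apply: measurableT_comp => //; exact/measurable_EFinP.
by apply: lte_mul_pinfty => //; have /integrableP[] := iv.
Qed.

(* [hyp_log_potential] is a real integral, hence [0] where its integrand is not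
   integrable; Fubini's theorem makes this a null set of [z] in [Q]. *)
Let potential0 : {ae area, forall z, (\int[nu]_w (f (z, w))%:E = 0)%E}.
Proof.
have N : area.-negligible [set z | Omega z /\ hyp_log_potential Omega u z <> 0].
  apply: hyp_negligible_area; first by move=> z [/Omega_disk].
  apply: negligibleS Lu0 => z /= [Oz Lz] h; apply: Lz.
  by rewrite h// mul0r.
have I := ae_integrable1 if_.
have N' : {ae area, forall z, ~ (Omega z /\ hyp_log_potential Omega u z <> 0)}.
  by apply: negligibleS N => z /= /contrapT.
move: N' I; apply: filterS2 => z /= hz iz.
have [zQ|zQ] := pselect (Q z); last first.
  apply: integral0_eq => w _; rewrite /f /= patchE memNset//.
  by rewrite !mul0r.
(* Fubini's theorem gives integrability in w of the product with [lap z]; dividing by [lap z]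
   recovers it for the kernel times [v], hence the separate case. *)
have [l0|l0] := eqVneq (lap z) 0.
  apply: integral0_eq => w _; rewrite /f /= patchE mem_set// l0.
  by rewrite !mul0r.
have Lz : hyp_log_potential Omega u z = 0.
  by apply: contrapT => Lz; apply: hz; split => //; exact: QO.
have fE w : (f (z, w))%:E = ((lap z)%:E * (hyp_green z w * v w)%:E)%E.
  by rewrite /f /= patchE mem_set// -EFinM mulrA.
have ig : nu.-integrable setT (EFin \o (fun w => hyp_green z w * v w)).
  have := integrableZl measurableT (lap z)^-1 iz.
  apply: eq_integrable => // w _.
  by rewrite fE -EFinM/= mulrA mulVf// mul1r.
under eq_integral do rewrite fE.
rewrite integralZl//.
have -> : (\int[nu]_w (hyp_green z w * v w)%:E = 0)%E; last by rewrite mule0.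
have fin := integrable_fin_num measurableT ig.
rewrite -(fineK fin); congr EFin.
move: Lz; rewrite /hyp_log_potential => /eqP; rewrite mulf_eq0 invr_eq0 pnatr_eq0/=.
move=> /eqP <-; rewrite /Rintegral; congr fine.
rewrite /= nuE; last by move=> w /v_out ->; rewrite mulr0.
by apply: eq_integral => w wO; rewrite /v patchE wO.
Qed.

Lemma integral_cutoff0 :
  (\int[nu]_w (v w * (cutoff a p q w.1 * cutoff b p' q' w.2))%:E = 0)%E.
Proof.
pose phi (w : plane R) := cutoff a p q w.1 * cutoff b p' q' w.2.
have F := Fubini if_.
have L0 : (\int[sfarea]_z \int[nu]_w (f (z, w))%:E = 0)%E.
  transitivity (\int[area]_z (cst 0 z : \bar R))%E; last exact: integral0.
  apply: ae_eq_integral => //; first exact: (measurable_fubini_F if_).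
  by apply: filterS potential0 => z /= ->.
have inner w : (\int[sfarea]_z (f (z, w))%:E =
    (- (bump_mass / 2))%:E * (v w * phi w)%:E)%E.
  have [Ow|nOw] := pselect (Omega w); last first.
    rewrite (v_out nOw) mul0r mule0; apply: integral0_eq => z _.
    by rewrite /f /= (v_out nOw) mulr0.
  have wD := Omega_disk Ow.
  transitivity (\int[area]_(z in Q) ((v w)%:E * (lap z * hyp_green z w)%:E))%E.
    rewrite [RHS]integral_mkcond; apply: eq_integral => z _.
    rewrite /f /= !patchE; case: ifPn => _; last by rewrite !mul0r.
    by rewrite -EFinM mulrC.
  rewrite integralZl//; last first.
    apply: integrable_laplacianM => //.
      exact: (measurableT_comp measurable_hyp_green (pair2_measurable w)).
    by move=> z Qz; apply: hyp_green_le => //; exact: QD.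
  rewrite (integral_laplacian_hyp_green pq p'q' ap aq bp bq a0 b0 QD wD).
  by rewrite -!EFinM; congr EFin; rewrite mulrCA.
move: F; rewrite /= L0 => /esym; under eq_integral do rewrite inner.
have [Ca Ca0 aC] := cutoff_le a p q; have [Cb Cb0 bC] := cutoff_le b p' q'.
have mphi : measurable_fun setT phi.
  apply: measurable_funM.
    exact: (measurableT_comp (measurable_cutoff _ _ _) (@measurable_fst _ _ _ _)).
  exact: (measurableT_comp (measurable_cutoff _ _ _) (@measurable_snd _ _ _ _)).
have ivphi : nu.-integrable setT (EFin \o (fun w => v w * phi w)).
  have := integrableZl measurableT (Ca * Cb) iv; apply: le_integrable => //.
    by apply/measurable_EFinP; exact: measurable_funM.
  move=> w _ /=; rewrite lee_fin !normrM (ger0_norm Ca0) (ger0_norm Cb0) mulrC.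
  by rewrite ler_wpM2r// ler_pM.
(* The factor - [bump_mass] / 2 is nonzero, so the integral against the test function must
   vanish. *)
rewrite integralZl// => /eqP; rewrite mule_eq0 => /orP[|/eqP//].
by rewrite eqe oppr_eq0 mulf_eq0 invr_eq0 pnatr_eq0/= orbF gt_eqF// bump_mass_gt0.
Qed.

End fixed_box.

Lemma integral_obox0 p q p' q' : p < q -> p' < q' -> box p q p' q' `<=` Omega ->
  (\int[nu]_(w in obox p q p' q') (v w)%:E = 0)%E.
Proof.
move=> pq p'q' QO.
pose phi n (w : plane R) :=
  cutoff (plateau p q n) p q w.1 * cutoff (plateau p' q' n) p' q' w.2.
pose chi (w : plane R) : R :=
  \1_(`]p, q[%classic) (w.1 : R) * \1_(`]p', q'[%classic) (w.2 : R).
have mphi n : measurable_fun setT (phi n).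
  apply: measurable_funM.
    exact: (measurableT_comp (measurable_cutoff _ _ _) (@measurable_fst _ _ _ _)).
  exact: (measurableT_comp (measurable_cutoff _ _ _) (@measurable_snd _ _ _ _)).
have mf_ n : measurable_fun setT (fun w => (v w * phi n w)%:E).
  by apply/measurable_EFinP; exact: measurable_funM.
have cv w : (v w * phi n w)%:E @[n --> \oo] --> (v w * chi w)%:E.
  apply: cvg_EFin; first by near=> n.
  apply: cvgM; first exact: cvg_cst.
  by apply: cvgM; exact: cvg_cutoff_plateau.
have mf : measurable_fun setT (fun w => (v w * chi w)%:E).
  by apply: (emeasurable_fun_cvg (fun n w => (v w * phi n w)%:E)).
have le : {ae nu, forall w n, setT w -> (`|(v w * phi n w)%:E| <= `|(v w)%:E|)%E}.
  apply: aeW => w n _; rewrite /= lee_fin normrM ler_piMr// normrM.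
  by rewrite mulr_ile1//; exact: cutoff_plateau_le1.
have cv' : {ae nu, forall w, setT w ->
    (v w * phi n w)%:E @[n --> \oo] --> (v w * chi w)%:E}.
  by apply: aeW => w _; exact: cv.
have [_ _ h] := dominated_convergence measurableT mf_ mf cv' (integrable_abse iv) le.
transitivity (\int[nu]_w (v w * chi w)%:E)%E.
  rewrite integral_mkcond; apply: eq_integral => w _.
  rewrite patchE /chi !indicE /obox in_setX.
  by do 2 case: (_ \in _); rewrite /= ?mulr1 ?mulr0.
rewrite -(cvg_lim _ h)//; apply: cvg_lim => //.
rewrite (_ : [sequence _]_n = cst 0%E); first exact: cvg_cst.
apply/funext => n /=; apply: integral_cutoff0 => //.
- by apply: flat_at_plateau; rewrite subrr mul0r.
- by apply: flat_at_plateau; rewrite subrr mulr0.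
- by apply: flat_at_plateau; rewrite subrr mul0r.
- by apply: flat_at_plateau; rewrite subrr mulr0.
- by move=> x; exact: plateau_ge0.
- by move=> x; exact: plateau_ge0.
Unshelve. all: by end_near. Qed.

Lemma ae_eq0_of_potential0 : open Omega -> ae_eq hyp_measure Omega u (cst 0).
Proof.
move=> oO; have [F [OF hF]] := open_bigcup_obox oO.
have nF n : ae_eq nu (F n) v (cst 0).
  case: (hF n) => [->|[p [q [p' [q' [pq p'q' QO ->]]]]]].
    by apply: aeW => w /= [].
  apply: ae_eq0_obox => // s t /andP[ps sq] /andP[pt tq].
  apply: integral_obox0 => // w [/=]; rewrite !in_itv/= => /andP[h1 h2] /andP[h3 h4].
  apply: QO; split; rewrite /= in_itv/= ?h2 ?h4 andbT.
    exact: le_trans h1.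
  exact: le_trans h3.
(* One exceptional null set for each box of the countable cover of [Omega]. *)
have [A [mA A0 hA]] : nu.-negligible (\bigcup_n ~` [set w | F n w -> v w = 0]).
  by apply: negligible_bigcup => n; exact: nF.
exists (A `&` Omega); split; first exact: measurableI.
  exact: etrans (esym (nu_restr mA)) A0.
move=> w /= nw; have Ow : Omega w by apply: contrapT => nOw; apply: nw => /nOw.
split => //; apply: hA; have [n _ Fw] : (\bigcup_n F n) w by rewrite -OF.
exists n => // h; apply: nw => _; rewrite -(h Fw) /v patchE mem_set//.
Qed.

End vanishing_potential.

Theorem theorem1p4 (R : realType) (Omega : set (plane R))
    (Omega_disk : Omega `<=` unit_disk)
    (Omega_open : open Omega)
    (Omega_bounded : hyp_bounded Omega) :
  ~ L2_eigenvalue Omega (hyp_log_potential Omega) 0.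
Proof.
move=> [u [uL2 u0 Lu0]]; apply: u0.
have mO := measurable_open_plane Omega_open.
have [r r1 Or] := hyp_bounded_nsq Omega_disk Omega_bounded.
have Ooo := hyp_measure_lty mO Omega_disk r1 Or.
by apply: (ae_eq0_of_potential0 Omega_disk mO Ooo uL2 (nu := mfrestr mO Ooo)).
Qed.
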